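(* There is an absolute constant $c\in\mathbb{N}$ such that, for every set $D$, every measure $\mu$ on $D$ and every class $F$ satisfying (B.1) $F$ is a separable metric space of complex-valued functions on $D$ such that function evaluation $f\mapsto f(x)$ is, for each $x\in D$, continuous on $F$, and (B.2) $F$ is continuously embedded into $L_2=L_2(\mu)$, and for all $m\in\mathbb{N}$, we have $$g^{\mathrm{lin}}_{cm}(F,L_2)\;\le\;\frac{1}{\sqrt m}\sum_{k>m}\frac{a_k(F,L_2)}{\sqrt k}.$$
   Context: $L_2(\mu)$ is the space of complex-valued square-integrable functions with norm $\|f\|_2=(\int_D|f|^2d\mu)^{1/2}$. For a class $F$ of complex-valued functions on $D$ and a seminormed space $G$ containing $F$, the $n$-th linear sampling number is $$g_n^{\mathrm{lin}}(F,G):=\inf_{x_1,\dots,x_n\in D,\ \varphi_1,\dots,\varphi_n\in G}\ \sup_{f\in F}\Big\|f-\sum_{i=1}^n f(x_i)\varphi_i\Big\|_G,$$ and the $n$-th approximation number (linear width) is $$a_n(F,G):=\inf_{T,\ \mathrm{rank}(T)\le n}\ \sup_{f\in F}\|f-Tf\|_G,$$ where the infimum is over linear operators $T$ (defined on the linear span of $F$, with values in $G$) of rank at most $n$. The right-hand side of the claim may be $+\infty$. *)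

(* Defs.v *)
From mathcomp Require Import all_boot all_order all_algebra.
From mathcomp Require Import all_classical all_reals all_analysis.
From mathcomp Require Import complex.

Set Implicit Arguments.
Unset Strict Implicit.
Unset Printing Implicit Defensive.

Import Order.TTheory GRing.Theory Num.Theory.
Import numFieldNormedType.Exports.
Import ComplexField.Normc.

Local Open Scope classical_set_scope.
Local Open Scope complex_scope.
Local Open Scope ring_scope.

Section LinearOperators.
Context {K : nzRingType} {V W : lmodType K}.

Definition linear_span (A : set V) : set V :=
  [set v | exists (k : nat) (a : 'I_k -> K) (u : 'I_k -> V),
     (forall i, A (u i)) /\ v = \sum_(i < k) a i *: u i].

(* A linear operator defined on [U] only: values of [T] off [U] are junk. *)
Definition linear_on (U : set V) (T : V -> W) : Prop :=
  forall (a : K) (u v : V), U u -> U v -> T (a *: u + v) = a *: T u + T v.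

(* The range of [T] on [U] lies in the span of [n] vectors; for a linear [T]
   this says that the range has dimension at most [n]. *)
Definition rank_le_on (n : nat) (U : set V) (T : V -> W) : Prop :=
  exists psi : 'I_n -> W, forall u, U u ->
    exists a : 'I_n -> K, T u = \sum_(i < n) a i *: psi i.

End LinearOperators.

(* A seminormed space of functions on [D] is given by its carrier [G] together
   with a function [N] on all functions, of which only the restriction to [G]
   matters.  Suprema and infima are taken in the extended reals. *)
Section Widths.
Context {R : realType} {D : Type}.
Implicit Types (F G : set (D -> R[i])) (N : (D -> R[i]) -> \bar R).

Definition lin_sampling_number F G N (n : nat) : \bar R :=
  ereal_inf [set e | exists (x : 'I_n -> D) (phi : 'I_n -> D -> R[i]),
    (forall i, G (phi i)) /\
    e = ereal_sup [set N (f - \sum_(i < n) f (x i) *: phi i) | f in F]].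

Definition approximation_number F G N (n : nat) : \bar R :=
  ereal_inf [set e | exists T : (D -> R[i]) -> (D -> R[i]),
    [/\ linear_on (linear_span F) T,
        (forall f, linear_span F f -> G (T f)),
        rank_le_on n (linear_span F) T
      & e = ereal_sup [set N (f - T f) | f in F]]].

End Widths.

Section L2.
Context {d : measure_display} {T : measurableType d} {R : realType}.
Variable mu : {measure set T -> \bar R}.

Definition L2norm (f : T -> R[i]) : \bar R :=
  Lnorm mu 2%:E (fun x => (normc (f x))%:E).

(* Square-integrable functions, not identified modulo null sets. *)
Definition L2 : set (T -> R[i]) :=
  [set f | [/\ measurable_fun [set: T] (fun x => complex.Re (f x)),
               measurable_fun [set: T] (fun x => complex.Im (f x))
             & (L2norm f < +oo)%E]].

End L2.

(* A metric space of complex-valued functions on [D] is a metric space [X]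
   together with an injection [ev] of [X] into the functions on [D]; the class
   of functions itself is [range ev]. *)
Section FunctionClasses.
Context {R : realType} {D : Type} {X : metricType R}.
Variable ev : X -> D -> R[i].

Definition separable_space : Prop :=
  exists S : set X, countable S /\ dense S.

Definition separable_function_space : Prop :=
  [/\ injective ev, separable_space
    & forall x : D, continuous (fun f : X => ev f x : R[i]^o)].

Definition continuously_embedded (G : set (D -> R[i]))
    (N : (D -> R[i]) -> \bar R) : Prop :=
  (forall f : X, G (ev f)) /\
  (forall f : X, N (ev g - ev f) @[g --> f] --> 0%E).

End FunctionClasses.

(* Main.v *)
Require Import Defs.
From mathcomp Require Import all_boot all_order all_algebra.
From mathcomp Require Import all_classical all_reals all_analysis.
From mathcomp Require Import complex.
From mathcomp Require Import measurable_realfun.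
From mathcomp Require Import ring lra zify.

(** The approximation spaces of ranks [K 2^l], [K = 576 m], are orthonormalized
into one sequence [e_k], so that [f = sum_k c_k(f) e_k] almost everywhere, the
coefficients in the [l]-th block having square sum at most [a_(K 2^l)^2].
The algorithm is weighted least squares on the first [K] functions.  It is
stable if the weighted points give a lower frame bound for those functions and
an upper bound for the rest, rescaled by weights [w_k] with [sum_k w_k <= 2 K]
chosen so that the ellipsoid [sum_k |c_k|^2 / w_k <= S^2] contains the class,
where [S = sum_l 2^(l/2) a_(K 2^l)].  Such points are found by the barrier
method of Batson, Spielman and Srivastava: the next point and its weight exist
because the [mu]-average of the lower potential condition exceeds that of the
upper one.  The upper potential is weighted by the covariance [diag(w_k)], so
only its trace and norm matter and not the dimension; the infinite tail of the
expansion enters through a single function [tau] of small integral.  Condensing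
the series shows [12 S <= m^(-1/2) sum_(k > m) a_k k^(-1/2)], and a dense
sequence in the class suffices since point evaluations are continuous. *)

Set Implicit Arguments.
Unset Strict Implicit.
Unset Printing Implicit Defensive.

Import Order.TTheory GRing.Theory Num.Theory.
Import numFieldNormedType.Exports.

Local Open Scope classical_set_scope.
Local Open Scope complex_scope.
Local Open Scope ring_scope.

(** * Positive forms and the barrier method *)

(** The measure may be infinite and the class need not be a ball of a Hilbert space, so points are
    not drawn at random: a point is found only because some integral is positive, and hence some
    value of the integrand is. The barriers act on finite matrices, so the expansion is truncated at
    an index [D] beyond which the weights sum to at most [1/2]; [tau] is the sum of [w_k |e_k|^2]
    over those indices. The constants are linked as follows. Splitting complex samples into real
    ones doubles ranks and traces, so the barriers run with [4 K] in place of [K], and [32 K] points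
    leave the lower frame constant [32 K - 16 K]. Least squares then adds [124 S^2] to the squared
    projection error [S^2], and the passage from the dense sequence to the class raises [125] to
    [144 = 12^2]. The choice [K = 24^2 m] makes the loss [2 / sqrt K] of the condensation cancel
    this [12]. *)

Section QuadraticForms.
Context {R : realFieldType}.

Definition qform n (P : 'M[R]_n) (x : 'cV[R]_n) : R := (x^T *m P *m x) 0 0.

Definition psd n (P : 'M[R]_n) := P^T = P /\ forall x, 0 <= qform P x.
Definition posdef n (P : 'M[R]_n) := P^T = P /\ forall x, x != 0 -> 0 < qform P x.

Lemma trmx11 (A : 'M[R]_1) : A 0 0 = A^T 0 0.
Proof. by rewrite mxE. Qed.

Lemma qformE n (P : 'M[R]_n) x : qform P x = \sum_i \sum_j P i j * x i 0 * x j 0.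
Proof.
rewrite /qform mxE exchange_big; apply: eq_bigr => j _.
rewrite mxE mulr_suml; apply: eq_bigr => i _.
by rewrite mxE; ring.
Qed.

Lemma qformD n (P Q : 'M[R]_n) x : qform (P + Q) x = qform P x + qform Q x.
Proof. by rewrite /qform mulmxDr mulmxDl mxE. Qed.

Lemma qformZ n a (P : 'M[R]_n) x : qform (a *: P) x = a * qform P x.
Proof. by rewrite /qform -scalemxAr -scalemxAl mxE. Qed.

Lemma qformN n (P : 'M[R]_n) x : qform (- P) x = - qform P x.
Proof. by rewrite -scaleN1r qformZ mulN1r. Qed.

Lemma qform0 n (P : 'M[R]_n) : qform P 0 = 0.
Proof. by rewrite /qform mulmx0 mxE. Qed.

Lemma qform_scalar n a (x : 'cV[R]_n) : qform a%:M x = a * \sum_i x i 0 ^+ 2.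
Proof.
rewrite /qform mul_mx_scalar -scalemxAl mxE mxE; congr (_ * _).
by apply: eq_bigr => i _; rewrite mxE expr2.
Qed.

Lemma qform_rank1 n (v x : 'cV[R]_n) : qform (v *m v^T) x = ((v^T *m x) 0 0) ^+ 2.
Proof.
rewrite /qform mulmxA -mulmxA mxE big_ord1 expr2; congr (_ * _).
by rewrite [LHS]trmx11 trmx_mul trmxK.
Qed.

Lemma qform_conj n m (P : 'M[R]_n) (X : 'M[R]_(n, m)) x :
  qform (X^T *m P *m X) x = qform P (X *m x).
Proof. by rewrite /qform trmx_mul !mulmxA. Qed.

Lemma sqsum_gt0 n (x : 'cV[R]_n) : x != 0 -> 0 < \sum_i x i 0 ^+ 2.
Proof.
move=> x0; rewrite lt0r; apply/andP; split; last by apply: sumr_ge0 => i _; exact: sqr_ge0.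
apply: contra x0 => /eqP s0; apply/eqP/matrixP => i j; rewrite (ord1 j) !mxE.
have := psumr_eq0P (fun i _ => sqr_ge0 (x i 0)) s0 (i := i) isT.
by move/eqP; rewrite sqrf_eq0 => /eqP.
Qed.

Lemma posdef_psd n (P : 'M[R]_n) : posdef P -> psd P.
Proof.
move=> [sP P0]; split=> // x; have [->|/P0/ltW//] := eqVneq x 0.
by rewrite qform0.
Qed.

Lemma posdef_unit n (P : 'M[R]_n) : posdef P -> P \in unitmx.
Proof.
move=> [sP P0]; rewrite -row_free_unit -kermx_eq0; apply/eqP/row_matrixP => i.
rewrite row0; apply/eqP/negPn/negP => k0.
have : 0 < qform P (row i (kermx P))^T.
  by apply: P0; rewrite -trmx0 (inj_eq trmx_inj).
rewrite /qform trmxK -row_mul mulmx_ker row0 mul0mx mxE ltxx //.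
Qed.

Lemma posdef_inv n (P : 'M[R]_n) : posdef P -> posdef (invmx P).
Proof.
move=> pP; have uP := posdef_unit pP; case: (pP) => sP P0.
have sI : (invmx P)^T = invmx P by rewrite trmx_inv sP.
split=> // x x0.
have -> : invmx P = (invmx P)^T *m P *m invmx P by rewrite sI mulVmx // mul1mx.
rewrite qform_conj; apply: P0; apply: contra x0 => /eqP e.
by rewrite -[x]mul1mx -(mulmxV uP) -mulmxA e mulmx0.
Qed.

Lemma psd_conj n m (P : 'M[R]_n) (X : 'M[R]_(n, m)) : psd P -> psd (X^T *m P *m X).
Proof.
move=> [sP P0]; split=> [|x]; last by rewrite qform_conj.
by rewrite !trmx_mul trmxK sP mulmxA.
Qed.

Lemma psdD n (P Q : 'M[R]_n) : psd P -> psd Q -> psd (P + Q).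
Proof.
move=> [sP P0] [sQ Q0]; split=> [|x]; first by rewrite linearD /= sP sQ.
by rewrite qformD addr_ge0.
Qed.

Lemma psdZ n a (P : 'M[R]_n) : 0 <= a -> psd P -> psd (a *: P).
Proof.
move=> a0 [sP P0]; split=> [|x]; first by rewrite linearZ /= sP.
by rewrite qformZ mulr_ge0.
Qed.

Lemma posdefD n (P Q : 'M[R]_n) : posdef P -> psd Q -> posdef (P + Q).
Proof.
move=> [sP P0] [sQ Q0]; split=> [|x x0]; first by rewrite linearD /= sP sQ.
by rewrite qformD ltr_wpDr ?P0.
Qed.

Lemma psd_rank1 n t (v : 'cV[R]_n) : 0 <= t -> psd (t *: (v *m v^T)).
Proof.
move=> t0; apply: psdZ => //; split=> [|x]; first by rewrite trmx_mul trmxK.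
by rewrite qform_rank1 sqr_ge0.
Qed.

Lemma posdef_scalar n a : 0 < a -> posdef (a%:M : 'M[R]_n).
Proof.
move=> a0; split=> [|x x0]; first by rewrite tr_scalar_mx.
by rewrite qform_scalar mulr_gt0 ?sqsum_gt0.
Qed.

Lemma qform_delta n (P : 'M[R]_n) k : qform P (delta_mx k 0) = P k k.
Proof.
rewrite qformE (bigD1 k) //= (bigD1 k) //= !mxE !eqxx !mulr1 !big1 ?addr0 //.
  move=> i ik; rewrite big1 // => j _; rewrite !mxE (negPf ik) mulr0 mul0r //.
by move=> j jk; rewrite !mxE (negPf jk) mulr0.
Qed.

Lemma psd_diag_ge0 n (P : 'M[R]_n) k : psd P -> 0 <= P k k.
Proof. by case=> _ P0; rewrite -qform_delta. Qed.

Lemma posdef_diag_gt0 n (P : 'M[R]_n) k : posdef P -> 0 < P k k.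
Proof.
case=> _ P0; rewrite -qform_delta P0 //; apply/eqP => /matrixP/(_ k 0).
by rewrite !mxE !eqxx => /eqP; rewrite oner_eq0.
Qed.

Lemma psd_tr_ge0 n (P : 'M[R]_n) : psd P -> 0 <= \tr P.
Proof. by move=> pP; apply: sumr_ge0 => k _; exact: psd_diag_ge0. Qed.

Lemma qform_comb n (P : 'M[R]_n) (y z : 'cV[R]_n) a b : P^T = P ->
  qform P (a *: y - b *: z) =
  a ^+ 2 * qform P y + b ^+ 2 * qform P z - 2 * a * b * (y^T *m P *m z) 0 0.
Proof.
move=> sP; have sy : (z^T *m P *m y) 0 0 = (y^T *m P *m z) 0 0.
  by rewrite [LHS]trmx11 !trmx_mul trmxK sP mulmxA.
have -> : qform P (a *: y - b *: z) =
    a * (a * (y^T *m P *m y) 0 0 - b * (y^T *m P *m z) 0 0) -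
    b * (a * (z^T *m P *m y) 0 0 - b * (z^T *m P *m z) 0 0).
  have e : (a *: y - b *: z)^T = a *: y^T - b *: z^T by apply/matrixP => i j; rewrite !mxE.
  rewrite /qform e.
  rewrite -mulmxA mulmxBl -!scalemxAl !mulmxBr -!scalemxAr !mulmxA.
  by move: (y^T *m P *m y) (y^T *m P *m z) (z^T *m P *m y) => A B C; rewrite !mxE.
by rewrite sy /qform; ring.
Qed.

(** The trace stands in for the largest eigenvalue, which need not lie in the field. Nonnegativity
    of the form at [x_j e_i - x_i e_j] bounds each mixed term, and these bounds add up to the
    claim. *)
Lemma psd_qform_le n (P : 'M[R]_n) x : psd P -> qform P x <= \tr P * \sum_i x i 0 ^+ 2.
Proof.
move=> [sP P0].
have key i j : 2 * (P i j * x i 0 * x j 0) <= P i i * x j 0 ^+ 2 + P j j * x i 0 ^+ 2.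
  have [->|ij] := eqVneq i j; first by lra.
  have := P0 (x j 0 *: delta_mx i 0 - x i 0 *: delta_mx j 0).
  rewrite (qform_comb _ _ _ _ sP) !qform_delta.
  have -> : ((delta_mx i 0)^T *m P *m delta_mx j 0 : 'M[R]_1) 0 0 = P i j.
    by rewrite trmx_delta -rowE -colE !mxE.
  lra.
have e : 2 * (\tr P * \sum_i x i 0 ^+ 2) =
   \sum_i \sum_j (P i i * x j 0 ^+ 2 + P j j * x i 0 ^+ 2).
  under [RHS]eq_bigr do rewrite big_split /= -mulr_sumr -mulr_suml.
  by rewrite big_split /= -mulr_suml -mulr_sumr /mxtrace; ring.
have : 2 * qform P x <= 2 * (\tr P * \sum_i x i 0 ^+ 2).
  rewrite e qformE mulr_sumr; apply: ler_sum => i _.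
  by rewrite mulr_sumr; apply: ler_sum.
by rewrite ler_pM2l.
Qed.

(** Nonnegativity of [P] at [x - s P^-1 y] for the minimizing [s = a / b], with [a = x^T y] and
    [b = qform P^-1 y]. *)
Lemma posdef_cauchy n (P : 'M[R]_n) (x y : 'cV[R]_n) : posdef P ->
  ((x^T *m y) 0 0) ^+ 2 <= qform P x * qform (invmx P) y.
Proof.
move=> pP; have uP := posdef_unit pP; have [sP _] := pP.
have [_ P0] := posdef_psd pP; have pI := posdef_inv pP.
have sI : (invmx P)^T = invmx P by case: pI.
have [->|y0] := eqVneq y 0; first by rewrite mulmx0 qform0 mxE mulr0 expr0n.
have b0 : 0 < qform (invmx P) y by case: pI => _; apply.
set b := qform _ y in b0 *; set a := (_ 0 0).
have := P0 (x - (a / b) *: (invmx P *m y)).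
have -> : qform P (x - (a / b) *: (invmx P *m y)) =
    qform P x - 2 * (a / b) * a + (a / b) ^+ 2 * b.
  rewrite -[X in qform P (X - _)]scale1r (qform_comb _ _ _ _ sP).
  have -> : qform P (invmx P *m y) = b by rewrite /qform trmx_mul sI mulmxKV // mulmxA.
  rewrite (mulmxA _ (invmx P)) mulmxK // -/a; ring.
have -> : qform P x - 2 * (a / b) * a + (a / b) ^+ 2 * b = qform P x - a ^+ 2 / b.
  by field; rewrite gt_eqF.
by rewrite subr_ge0 ler_pdivrMr.
Qed.

(** The Sherman-Morrison formula, verified by multiplying out: the middle factor [v^T P^-1 v] is a
    scalar and can be pulled out. *)
Lemma invmx_rank1 n (P : 'M[R]_n) t (v : 'cV[R]_n) :
  P \in unitmx -> 1 + t * qform (invmx P) v != 0 ->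
  invmx (P + t *: (v *m v^T)) =
  invmx P - (t / (1 + t * qform (invmx P) v)) *: (invmx P *m v *m (v^T *m invmx P)).
Proof.
move=> uP s0; set s := 1 + _ in s0 *; set X := (X in _ = X).
have e : (P + t *: (v *m v^T)) *m X = 1%:M.
  rewrite /X mulmxBr mulmxDl mulmxV // -scalemxAl -scalemxAr mulmxDl.
  rewrite (mulmxA P) (mulmxA P) mulmxV // mul1mx -scalemxAl.
  have -> : v *m v^T *m (invmx P *m v *m (v^T *m invmx P)) =
     qform (invmx P) v *: (v *m (v^T *m invmx P)).
    rewrite !mulmxA -(mulmxA v) -(mulmxA v) [v^T *m _ *m v]mx11_scalar mul_mx_scalar.
    by rewrite -!scalemxAl !mulmxA.
  rewrite -(mulmxA v v^T); move: (v *m (v^T *m invmx P)) => Y.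
  rewrite -[RHS]addr0 -addrA; congr (_ + _); apply/matrixP => i j; rewrite !mxE.
  by rewrite /s in s0 *; field.
have [u _] := mulmx1_unit e.
by rewrite -[RHS]mul1mx -(mulVmx u) -mulmxA e mulmx1.
Qed.

Lemma mxtrace_rank1 n (C M : 'M[R]_n) v : M^T = M ->
  \tr (C *m (M *m v *m (v^T *m M))) = qform (M *m C *m M) v.
Proof.
move=> sM; rewrite !mulmxA mxtrace_mulC !mulmxA.
by rewrite mxtrace_mulC !mulmxA /mxtrace big_ord1 /qform !mulmxA.
Qed.

End QuadraticForms.

(** * Moving a barrier and compensating by a rank-one update *)

Section Barriers.
Context {R : realFieldType}.

Lemma resolvent_sub n (P : 'M[R]_n) a : P \in unitmx -> P + a%:M \in unitmx ->
  invmx P - invmx (P + a%:M) = a *: (invmx P *m invmx (P + a%:M)).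
Proof.
move=> uP uQ; set Q := P + a%:M in uQ *.
have e : Q - P = a%:M by rewrite /Q addrAC subrr add0r.
have -> : invmx P - invmx Q = invmx P *m (Q - P) *m invmx Q.
  by rewrite mulmxBr mulmxBl mulmxK // mulVmx // mul1mx.
by rewrite e mul_mx_scalar -scalemxAl.
Qed.

Lemma resolvent_comm n (P : 'M[R]_n) a : P \in unitmx -> P + a%:M \in unitmx ->
  invmx P *m invmx (P + a%:M) = invmx (P + a%:M) *m invmx P.
Proof.
move=> uP uQ; set Q := P + a%:M in uQ *.
have c : P *m Q = Q *m P by rewrite /Q mulmxDr mulmxDl scalar_mxC.
have uPQ : P *m Q \in unitmx by rewrite unitmx_mul uP.
apply: (can_inj (mulKmx uPQ)); rewrite {1}c !mulmxA mulmxK // mulmxV //.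
by rewrite mulmxK // mulmxV.
Qed.

Lemma posdef_conj n (P X : 'M[R]_n) : posdef P -> X \in unitmx -> posdef (X^T *m P *m X).
Proof.
move=> pP uX; have [? _] := psd_conj X (posdef_psd pP); split=> // x x0.
case: pP => _; rewrite qform_conj; apply; apply: contra x0 => /eqP e.
by rewrite -[x](mulKmx uX) e mulmx0.
Qed.

Lemma posdef_tr_gt0 n (P : 'M[R]_n) : (0 < n)%N -> posdef P -> 0 < \tr P.
Proof.
case: n P => // n P _ pP; rewrite /mxtrace big_ord_recl ltr_pwDl ?posdef_diag_gt0 //.
by apply: sumr_ge0 => i _; exact/ltW/posdef_diag_gt0.
Qed.

(* The bound on [tr N^2] with [N = (P - 1)^-1], [N0 = P^-1] and [c = tr (N0 N)]
   is Cauchy-Schwarz for the form [X, Y |-> tr (X^T N0 Y)] at [1] and [N]. *)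
Lemma lower_barrier_trace n (P : 'M[R]_n) : (0 < n)%N -> posdef P ->
  \tr (invmx P) <= 1 / 4 -> posdef (P - 1%:M) /\
  exists c, [/\ 0 < c, c = \tr (invmx (P - 1%:M)) - \tr (invmx P) &
    3 / 4 <= \tr (c^-1 *: (invmx (P - 1%:M) *m invmx (P - 1%:M)) - invmx (P - 1%:M))].
Proof.
move=> n0 pP trP; have uP := posdef_unit pP; have [sP P0] := pP.
have pI := posdef_inv pP; have psI := posdef_psd pI.
(* With [s = |x|^2] and [p = qform P x], Cauchy-Schwarz and the trace bound give [s^2 <= p s / 4].
   Hence [P >= 4], and the form stays positive after the shift by 1. *)
have pQ : posdef (P - 1%:M).
  split=> [|x x0]; first by rewrite linearB /= sP tr_scalar_mx.
  rewrite qformD qformN qform_scalar mul1r.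
  have s0 := sqsum_gt0 x0; set s := \sum_i _ in s0 *.
  have := posdef_cauchy x x pP.
  have -> : (x^T *m x) 0 0 = s by rewrite mxE; apply: eq_bigr => i _; rewrite mxE expr2.
  have := psd_qform_le x psI; rewrite -/s.
  have := P0 _ x0; move: (qform P x) (qform (invmx P) x) (\tr (invmx P)) trP => p q t t4 p0 qt sq.
  have : s ^+ 2 <= p * (1 / 4 * s).
    apply: (le_trans sq); rewrite ler_pM2l //; apply: (le_trans qt).
    by rewrite ler_pM2r.
  have -> : p * (1 / 4 * s) = (p * (1 / 4)) * s by ring.
  by rewrite expr2 ler_pM2r //; lra.
split=> //; set Q := P - 1%:M in pQ *; have uQ := posdef_unit pQ.
have eP : P = Q + 1%:M by rewrite /Q subrK.
set N := invmx Q; set N0 := invmx P.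
have pN : posdef N by exact: posdef_inv.
have [sN _] := pN.
have sN0 : N0^T = N0 by case: pI.
have eD : N - N0 = N *m N0.
  by have := @resolvent_sub _ Q 1 uQ; rewrite -?eP // scale1r; apply.
have com : N *m N0 = N0 *m N.
  by have := @resolvent_comm _ Q 1 uQ; rewrite -?eP //; apply.
set s := \tr (N0 *m N).
have ec : \tr N - \tr N0 = s by rewrite -linearB /= eD com.
set w := \tr (N *m N0 *m N).
have etr : \tr (N *m N) = s + w.
  have -> : N *m N = N0 *m N + N *m N0 *m N.
    by rewrite -mulmxDl -eD addrC subrK.
  by rewrite linearD.
have s0 : 0 < s.
  rewrite /s; have -> : N0 *m N = N0^T *m 1%:M *m N0 + N0^T *m N *m N0.
    by rewrite sN0 mulmx1 -[X in N0 *m X = _](subrK N0 N) eD mulmxDr mulmxA addrC.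
  rewrite linearD /= ltr_pwDl ?psd_tr_ge0 //; last exact/psd_conj/posdef_psd.
  apply: posdef_tr_gt0 => //; apply: posdef_conj; first exact: posdef_scalar.
  by rewrite unitmx_inv.
exists s; split => //.
have : 0 <= \tr ((1%:M - s^-1 *: N)^T *m N0 *m (1%:M - s^-1 *: N)).
  by apply: psd_tr_ge0; apply: psd_conj.
have -> : \tr ((1%:M - s^-1 *: N)^T *m N0 *m (1%:M - s^-1 *: N)) = \tr N0 - 2 + w / s ^+ 2.
  have -> : (1%:M - s^-1 *: N)^T = 1%:M - s^-1 *: N.
    by rewrite linearB /= linearZ /= sN tr_scalar_mx.
  have -> : (1%:M - s^-1 *: N) *m N0 *m (1%:M - s^-1 *: N) =
      N0 - s^-1 *: (N0 *m N) - s^-1 *: (N *m N0) + (s^-1 ^+ 2) *: (N *m N0 *m N).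
    rewrite mulmxBr mulmx1 mulmxBl mul1mx -!scalemxAl -scalemxAr mulmxBl -!scalemxAl.
    move: (N *m N0 *m N) (N0 *m N) (N *m N0) => Y1 Y2 Y3.
    by apply/matrixP => i j; rewrite !mxE; ring.
  rewrite !mxtraceD !raddfN /= !mxtraceZ (mxtrace_mulC N) -/s -/w.
  by field; rewrite gt_eqF.
move: trP; rewrite raddfB /= mxtraceZ etr -/N -/N0 => trP.
have -> : \tr N = s + \tr N0 by rewrite -ec subrK.
have -> : s^-1 * (s + w) = 1 + (w / s ^+ 2) * s by field; rewrite gt_eqF.
move: (\tr N0) (w / s ^+ 2) trP => p q p4 h.
(* Since [q >= 2 - p >= 7/4], the trace [1 + q s - (s + p)] is at least [3/4 + (3/4) s]. *)
have : (7 / 4) * s <= q * s by rewrite ler_pM2r //; lra.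
lra.
Qed.

(* By Sherman-Morrison, [L = N^2 / c - N] is the form for which an update of
   size [t] keeps the potential [tr P^-1] from growing as soon as [1 / t <= L v]. *)
Lemma lower_barrier_step n (P : 'M[R]_n) : (0 < n)%N -> posdef P ->
  \tr (invmx P) <= 1 / 4 -> exists2 L : 'M[R]_n, 3 / 4 <= \tr L &
    forall v t, 0 < t -> t^-1 <= qform L v ->
      posdef (P - 1%:M + t *: (v *m v^T)) /\
      \tr (invmx (P - 1%:M + t *: (v *m v^T))) <= 1 / 4.
Proof.
move=> n0 pP trP; have [pQ [c [c0 ec trL]]] := lower_barrier_trace n0 pP trP.
exists (c^-1 *: (invmx (P - 1%:M) *m invmx (P - 1%:M)) - invmx (P - 1%:M)) => // v t t0 tL.
split; first by apply: posdefD => //; exact/psd_rank1/ltW.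
apply: le_trans trP; set Q := P - 1%:M in pQ ec tL *.
have pN := posdef_inv pQ; have [sN _] := pN; have [_ N0] := posdef_psd pN.
have s0 : 0 < 1 + t * qform (invmx Q) v by rewrite ltr_pwDl ?ltr01 // mulr_ge0 ?N0 // ltW.
rewrite invmx_rank1 ?posdef_unit ?gt_eqF // linearB /= linearZ /=.
have -> : \tr (invmx Q *m v *m (v^T *m invmx Q)) = qform (invmx Q *m invmx Q) v.
  by rewrite -[X in \tr X]mul1mx mxtrace_rank1 // mulmx1.
move: tL; rewrite qformD qformN qformZ.
move: (qform (invmx Q) v) (qform (invmx Q *m invmx Q) v) (N0 v) s0 => a b a0 s0.
rewrite lerBrDr ler_pdivlMl // => cab.
have ta : t^-1 + a = (1 + t * a) / t by field; rewrite gt_eqF.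
have -> : t / (1 + t * a) * b = b / (t^-1 + a) by rewrite ta; field; rewrite !gt_eqF.
(* The shift raised the potential by [c]; the update lowers it by [b / (t^-1 + a)]. *)
have : c <= b / (t^-1 + a) by rewrite ler_pdivlMr // ltr_pwDl ?invr_gt0.
by lra.
Qed.

(* Here [U = M + M D M / c] with [M = (Q + 3)^-1] and [c] the decrease of the
   potential [tr (D Q^-1)] when the barrier moves by [3]; [7 / 12 = 1 / 4 + 1 / 3]. *)
Lemma upper_barrier_step n (D Q : 'M[R]_n) (e : 'I_n -> R) : (0 < n)%N -> posdef Q ->
  D = diag_mx (\row_i e i) -> (forall i, 0 < e i <= 1) ->
  \tr (D *m invmx Q) <= 1 / 4 -> exists U : 'M[R]_n,
    [/\ psd U, \tr (D *m U) <= 7 / 12 & forall u t, 0 < t -> qform U u < t^-1 ->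
      posdef (Q + 3%:M - t *: (u *m u^T)) /\
      \tr (D *m invmx (Q + 3%:M - t *: (u *m u^T))) <= 1 / 4].
Proof.
move=> n0 pQ eD e01 trQ; have e0 i : 0 < e i by case/andP: (e01 i).
have trD (X : 'M[R]_n) : \tr (D *m X) = \sum_i e i * X i i.
  rewrite /mxtrace; apply: eq_bigr => i _; rewrite eD mxE (bigD1 i) //= !mxE eqxx mulr1n.
  by rewrite big1 ?addr0 // => j ji; rewrite !mxE eq_sym (negPf ji) mulr0n mul0r.
have trD_ge0 X : psd X -> 0 <= \tr (D *m X).
  move=> pX; rewrite trD; apply: sumr_ge0 => i _.
  by rewrite mulr_ge0 ?psd_diag_ge0 // ltW.
have pR : posdef (Q + 3%:M) by apply: posdefD => //; exact/posdef_psd/posdef_scalar.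
have [uQ uR] := (posdef_unit pQ, posdef_unit pR).
set M0 := invmx Q in trQ *; set M := invmx (Q + 3%:M).
have pM0 : posdef M0 by exact: posdef_inv.
have pM : posdef M by exact: posdef_inv.
have [sM _] := pM.
have eM : M0 - M = 3 *: (M0 *m M) by exact: resolvent_sub.
have com : M0 *m M = M *m M0 by exact: resolvent_comm.
set w := \tr (D *m (M *m M)).
have MM0M : psd (M *m M0 *m M) by rewrite -{1}sM; exact/psd_conj/posdef_psd.
set c := \tr (D *m M0) - \tr (D *m M).
(* The resolvent identity [M0 = M + 3 M0 M], applied twice, writes [c] as [3 w] plus a multiple of
   the nonnegative trace of [D M M0 M]. *)
have cw : 3 * w <= c.
  have -> : c = 3 * (w + 3 * \tr (D *m (M *m M0 *m M))).
    rewrite /c -linearB /= -mulmxBr eM -scalemxAr linearZ /= com; congr (_ * _).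
    rewrite [X in \tr (D *m X) = _](_ : _ = M *m M + 3 *: (M *m M0 *m M)).
      by rewrite mulmxDr linearD /= -scalemxAr linearZ.
    by rewrite -{1}(subrK M M0) eM mulmxDr -scalemxAr mulmxA addrC.
  by have := trD_ge0 _ MM0M; lra.
have w0 : 0 < w.
  have pMM : posdef (M *m M).
    by rewrite -[X in X *m M]mulmx1 -{1}sM; apply: posdef_conj; [exact: posdef_scalar|exact: posdef_unit].
  rewrite /w trD (bigD1 (Ordinal n0)) //= ltr_pwDl ?mulr_gt0 ?posdef_diag_gt0 //.
  by apply: sumr_ge0 => i _; exact/ltW/mulr_gt0/posdef_diag_gt0.
have c0 : 0 < c by apply: lt_le_trans cw; rewrite mulr_gt0.
(* The bound [e i <= 1] enters here: replacing the inner [D] by the identity can only increase the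
   trace. Together with [cw] this gives the summand [1/3]. *)
have DMDM : \tr (D *m (M *m D *m M)) <= w.
  rewrite /w !trD; apply: ler_sum => i _; rewrite ler_pM2l // -mulmxA.
  rewrite !mxE; apply: ler_sum => j _.
  have -> : (D *m M) j i = e j * M j i.
    rewrite eD mxE (bigD1 j) //= !mxE eqxx mulr1n big1 ?addr0 // => k kj.
    by rewrite !mxE eq_sym (negPf kj) mulr0n mul0r.
  have -> : M j i = M i j by rewrite -{1}sM mxE.
  have := sqr_ge0 (M i j); case/andP: (e01 j) => _ e1; nra.
have pD : psd D.
  rewrite eD; split=> [|x]; first by rewrite tr_diag_mx.
  rewrite qformE; apply: sumr_ge0 => i _; rewrite (bigD1 i) //= !mxE eqxx mulr1n big1 ?addr0.
    by rewrite -mulrA mulr_ge0 -?expr2 ?sqr_ge0 // ltW.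
  by move=> j ji; rewrite !mxE eq_sym (negPf ji) mulr0n !mul0r.
have psdMDM : psd (M *m D *m M) by rewrite -{1}sM; exact: psd_conj.
exists (M + c^-1 *: (M *m D *m M)); split.
- by apply: psdD; [exact: posdef_psd|apply: psdZ => //; rewrite invr_ge0 ltW].
- rewrite mulmxDr -scalemxAr linearD /= linearZ /=.
  have h : c^-1 * \tr (D *m (M *m D *m M)) <= 1 / 3 by rewrite ler_pdivrMl //; lra.
  by move: h c0 trQ; rewrite /c; lra.
move=> u t t0; rewrite qformD qformZ => tU.
have qM0 : 0 <= qform M u by case: (posdef_psd pM).
have qD0 : 0 <= qform (M *m D *m M) u by case: psdMDM.
have s1 : t * qform M u + t * (c^-1 * qform (M *m D *m M) u) < 1.
  by rewrite -mulrDr mulrC -ltr_pdivlMr // div1r.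
have c1 : 0 <= c^-1 * qform (M *m D *m M) u by rewrite mulr_ge0 // invr_ge0 ltW.
have s0 : t * qform M u < 1 by apply: le_lt_trans s1; rewrite lerDl mulr_ge0 // ltW.
have {}s0 : 0 < 1 - t * qform M u by rewrite subr_gt0.
split.
  split=> [|x x0].
    by case: pR => sR _; rewrite linearB /= sR linearZ /= trmx_mul trmxK.
  rewrite qformD qformN qformZ qform_rank1.
  have R0 : 0 < qform (Q + 3%:M) x by case: pR => _; apply.
  have := posdef_cauchy x u pR; rewrite -/M trmx11 trmx_mul trmxK.
  move: (qform (Q + 3%:M) x) R0 => a a0 h.
  have : t * (u^T *m x) 0 0 ^+ 2 <= t * (a * qform M u) by rewrite ler_pM2l.
  have := mulr_gt0 a0 s0; rewrite mulrBr mulr1 mulrCA; lra.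
have es : 1 + - t * qform M u = 1 - t * qform M u by rewrite mulNr.
rewrite -scaleNr invmx_rank1 ?es ?gt_eqF // -/M mulmxBr linearB /= -scalemxAr linearZ /=.
rewrite mxtrace_rank1 //.
have -> : - t / (1 - t * qform M u) * qform (M *m D *m M) u =
  - ((t * qform (M *m D *m M) u) / (1 - t * qform M u)) by field; rewrite gt_eqF.
rewrite opprK; apply: le_trans trQ.
have : (t * qform (M *m D *m M) u) / (1 - t * qform M u) <= c.
  rewrite ler_pdivrMr // -ler_pdivrMl // mulrA [c^-1 * t]mulrC -mulrA; lra.
by rewrite /c; lra.
Qed.

End Barriers.

Section Sparsification.
Context {R : realFieldType}.

Lemma qform_sum_rank1 (Omega : Type) n (s : seq (Omega * R)) (v : Omega -> 'cV[R]_n) x :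
  qform (\sum_(p <- s) p.2 *: (v p.1 *m (v p.1)^T)) x =
  \sum_(p <- s) p.2 * (\sum_i v p.1 i 0 * x i 0) ^+ 2.
Proof.
elim: s => [|p s IH]; first by rewrite !big_nil /qform mulmx0 mul0mx mxE.
rewrite !big_cons qformD IH qformZ qform_rank1; congr (_ * _ ^+ 2 + _).
by rewrite mxE; apply: eq_bigr => i _; rewrite mxE.
Qed.

(* The barriers start at [-4 K] and [4 K], so that both potentials start below
   [1 / 4], and move by [1] and [3] at each step; [3 / 4 > 7 / 12 + 1 / 12] makes
   room for [tau]. *)
Theorem barrier_sparsification (Omega : Type) (r N : nat) (K : R)
    (v : Omega -> 'cV[R]_r) (u : Omega -> 'cV[R]_N) (tau : Omega -> R) (e : 'I_N -> R) :
  (0 < r)%N -> (0 < N)%N -> r%:R <= K -> (forall i, 0 < e i <= 1) -> \sum_i e i <= K ->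
  (forall w, 0 <= tau w) ->
  (forall (P : 'M[R]_r) (Q : 'M[R]_N), psd Q ->
     \sum_k e k * Q k k + 1 / 12 < \tr P ->
     exists w, qform Q (u w) + tau w / 12 < qform P (v w)) ->
  forall n, exists s : seq (Omega * R), [/\ size s = n,
    all (fun p => 0 <= p.2) s,
    forall x : 'cV[R]_r, (n%:R - 4 * K) * \sum_i x i 0 ^+ 2 <=
      \sum_(p <- s) p.2 * (\sum_i v p.1 i 0 * x i 0) ^+ 2,
    forall y : 'cV[R]_N, \sum_(p <- s) p.2 * (\sum_i u p.1 i 0 * y i 0) ^+ 2 <=
      (4 * K + 3 * n%:R) * \sum_i y i 0 ^+ 2
    & \sum_(p <- s) p.2 * tau p.1 <= 12 * n%:R].
Proof.
move=> r0 N0 rK e01 eK tau0 sel n.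
have K0 : 0 < K by apply: lt_le_trans rK; rewrite ltr0n.
pose A (s : seq (Omega * R)) := \sum_(p <- s) p.2 *: (v p.1 *m (v p.1)^T).
pose B (s : seq (Omega * R)) := \sum_(p <- s) p.2 *: (u p.1 *m (u p.1)^T).
pose D := diag_mx (\row_i e i).
have trD (X : 'M[R]_N) : \tr (D *m X) = \sum_i e i * X i i.
  rewrite /mxtrace; apply: eq_bigr => i _; rewrite mxE (bigD1 i) //= !mxE eqxx mulr1n.
  by rewrite big1 ?addr0 // => j ji; rewrite !mxE eq_sym (negPf ji) mulr0n mul0r.
suff [s [szs s0 [pA _] [pB _] st]] : exists s : seq (Omega * R), [/\ size s = n,
    all (fun p => 0 <= p.2) s,
    posdef (A s - (n%:R - 4 * K)%:M) /\ \tr (invmx (A s - (n%:R - 4 * K)%:M)) <= 1 / 4,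
    posdef ((4 * K + 3 * n%:R)%:M - B s) /\
      \tr (D *m invmx ((4 * K + 3 * n%:R)%:M - B s)) <= 1 / 4
    & \sum_(p <- s) p.2 * tau p.1 <= 12 * n%:R].
  exists s; split=> // [x|y].
    case: (posdef_psd pA) => _ /(_ x).
    by rewrite qformD qformN qform_scalar qform_sum_rank1 subr_ge0.
  case: (posdef_psd pB) => _ /(_ y).
  by rewrite qformD qformN qform_scalar qform_sum_rank1 subr_ge0.
elim: n => [|n [s [szs s0 [pA trA] [pB trB] st]]].
  have K4 : 0 < 4 * K by rewrite mulr_gt0.
  exists [::]; split; rewrite /A /B ?big_nil ?mulr0 ?addr0 ?add0r ?subr0 //.
    rewrite -raddfN /= opprK; split; first exact: posdef_scalar.
    rewrite invmx_scalar mxtrace_scalar -[X in X <= _]mulr_natr [X in X <= _]mulrC ler_pdivrMr //.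
    by have -> : 1 / 4 * (4 * K) = K by field.
  split; first exact: posdef_scalar.
  rewrite invmx_scalar mul_mx_scalar linearZ /= [X in X <= _]mulrC ler_pdivrMr //.
  have -> : 1 / 4 * (4 * K) = K by field.
  apply: le_trans eK; rewrite -[D]mulmx1 trD; apply: ler_sum => i _.
  by rewrite mxE eqxx mulr1.
have en : n.+1%:R = n%:R + 1 :> R by rewrite -addn1 natrD.
have [L trL stepL] := lower_barrier_step r0 pA trA.
have [U [pU trU stepU]] := upper_barrier_step N0 pB erefl e01 trB.
have [|w hw] := sel L U pU; first by rewrite trD in trU; lra.
have U0 : 0 <= qform U (u w) by case: pU.
have tw := tau0 w.
have L0 : 0 < qform L (v w) by lra.
(* The smallest weight that satisfies the condition of the lower barrier. By the choice of [w],
   [qform U (u w) + tau w / 12 < 1 / t]: so the upper barrier accepts it as well, and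
   [t * tau w <= 12], the amount each step adds to the last bound. *)
pose t := (qform L (v w))^-1.
have t0 : 0 < t by rewrite invr_gt0.
have [pA' trA'] : posdef (A s - (n%:R - 4 * K)%:M - 1%:M + t *: (v w *m (v w)^T)) /\
   \tr (invmx (A s - (n%:R - 4 * K)%:M - 1%:M + t *: (v w *m (v w)^T))) <= 1 / 4.
  by apply: stepL => //; rewrite invrK.
have [pB' trB'] : posdef ((4 * K + 3 * n%:R)%:M - B s + 3%:M - t *: (u w *m (u w)^T)) /\
   \tr (D *m invmx ((4 * K + 3 * n%:R)%:M - B s + 3%:M - t *: (u w *m (u w)^T))) <= 1 / 4.
  by apply: stepU => //; rewrite invrK; lra.
have eA : A s - (n%:R - 4 * K)%:M - 1%:M + t *: (v w *m (v w)^T) =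
    A ((w, t) :: s) - (n.+1%:R - 4 * K)%:M.
  rewrite /A big_cons /= en; apply/matrixP => i j; rewrite !mxE.
  by case: (i == j); rewrite ?mulr1n ?mulr0n; ring.
have eB : (4 * K + 3 * n%:R)%:M - B s + 3%:M - t *: (u w *m (u w)^T) =
    (4 * K + 3 * n.+1%:R)%:M - B ((w, t) :: s).
  rewrite /B big_cons /= en; apply/matrixP => i j; rewrite !mxE.
  by case: (i == j); rewrite ?mulr1n ?mulr0n; ring.
rewrite eA in pA' trA'; rewrite eB in pB' trB'.
exists ((w, t) :: s); split=> //=.
- by rewrite szs.
- by rewrite s0 ltW.
rewrite big_cons /= en mulrDr mulr1 addrC lerD //.
by rewrite /t [X in X <= _]mulrC ler_pdivrMr //; lra.
Qed.

End Sparsification.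

(** * Complex least squares and orthonormalization *)

Section ComplexLinearAlgebra.
Context {R : rcfType}.
Local Notation C := R[i].
Implicit Types z w : C.

Definition normsq z : R := complex.Re z ^+ 2 + complex.Im z ^+ 2.

Lemma normsq_ge0 z : 0 <= normsq z.
Proof. by rewrite addr_ge0 ?sqr_ge0. Qed.

Lemma normsq0 : normsq 0 = 0.
Proof. by rewrite /normsq /= expr0n /= addr0. Qed.

Lemma normsq_eq0 z : normsq z = 0 -> z = 0.
Proof.
case: z => a b; rewrite /normsq /= => /eqP; rewrite paddr_eq0 ?sqr_ge0 // !sqrf_eq0.
by case/andP => /eqP -> /eqP ->.
Qed.

Lemma normsqM z w : normsq (z * w) = normsq z * normsq w.
Proof. by case: z w => [a b] [c d]; rewrite /normsq /=; ring. Qed.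

Lemma normsqN z : normsq (- z) = normsq z.
Proof. by case: z => [a b]; rewrite /normsq /= !sqrrN. Qed.

Lemma normsq_conj z : normsq (conjc z) = normsq z.
Proof. by case: z => [a b]; rewrite /normsq /= sqrrN. Qed.

Lemma mul_conjc z : conjc z * z = (normsq z)%:C.
Proof.
by case: z => [a b]; apply/eqP; rewrite eq_complex /normsq /=; apply/andP; split; apply/eqP; ring.
Qed.

Lemma normsqD z w : normsq (z + w) = normsq z + normsq w + 2 * complex.Re (conjc z * w).
Proof. by case: z w => [a b] [c d]; rewrite /normsq /=; ring. Qed.

Lemma normsqD_le z w : normsq (z + w) <= 2 * normsq z + 2 * normsq w.
Proof.
case: z w => [a b] [c d]; rewrite /normsq /=.
have := sqr_ge0 (a - c); have := sqr_ge0 (b - d); lra.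
Qed.

Lemma ReD z w : complex.Re (z + w) = complex.Re z + complex.Re w.
Proof. by case: z w => [a b] [c d]. Qed.

Lemma ImD z w : complex.Im (z + w) = complex.Im z + complex.Im w.
Proof. by case: z w => [a b] [c d]. Qed.

Lemma Re_sum (I : Type) (s : seq I) (P : pred I) (F : I -> C) :
  complex.Re (\sum_(i <- s | P i) F i) = \sum_(i <- s | P i) complex.Re (F i).
Proof. exact: (big_morph _ ReD). Qed.

Definition adj m n (M : 'M[C]_(m, n)) : 'M[C]_(n, m) := map_mx (@conjc R) M^T.

Lemma adj_mul m n p (M : 'M[C]_(m, n)) (N : 'M[C]_(n, p)) : adj (M *m N) = adj N *m adj M.
Proof. by rewrite /adj trmx_mul map_mxM. Qed.

Lemma adj_dot n (x : 'cV[C]_n) : (adj x *m x) 0 0 = (\sum_i normsq (x i 0))%:C.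
Proof.
rewrite mxE rmorph_sum; apply: eq_bigr => i _.
by rewrite !mxE mul_conjc.
Qed.

Lemma normsq_sumD n (x y : 'cV[C]_n) : \sum_i normsq ((x + y) i 0) =
  \sum_i normsq (x i 0) + \sum_i normsq (y i 0) + 2 * complex.Re ((adj x *m y) 0 0).
Proof.
rewrite [X in _ = _ + 2 * complex.Re X]mxE Re_sum mulr_sumr -!big_split /=.
by apply: eq_bigr => i _; rewrite !mxE normsqD.
Qed.

(* [B] is the pseudo-inverse [(M^* M)^-1 M^*], so [M B] is an orthogonal projection. *)
Lemma least_squares_inverse n r (M : 'M[C]_(n, r)) (a : R) : 0 < a ->
  (forall c : 'cV[C]_r, a * \sum_k normsq (c k 0) <= \sum_i normsq ((M *m c) i 0)) ->
  exists B : 'M[C]_(r, n), B *m M = 1%:M /\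
    forall y : 'cV[C]_n, a * \sum_k normsq ((B *m y) k 0) <= \sum_i normsq (y i 0).
Proof.
move=> a0 lbM; set G := adj M *m M.
have uG : G \in unitmx.
  rewrite -unitmx_tr -row_free_unit -kermx_eq0; apply/eqP/row_matrixP => i.
  rewrite row0; set c := row i (kermx G^T).
  have Gc : G *m c^T = 0 by rewrite -[G]trmxK -trmx_mul -row_mul mulmx_ker row0 trmx0.
  have : (adj (M *m c^T) *m (M *m c^T)) 0 0 = 0.
    by rewrite adj_mul -mulmxA (mulmxA (adj M)) Gc mulmx0 mxE.
  rewrite adj_dot => /complexI s0.
  have c0 : \sum_k normsq (c^T k 0) = 0.
    apply/eqP; rewrite eq_le sumr_ge0 ?andbT => [|k _]; last exact: normsq_ge0.
    by have := lbM c^T; rewrite s0 pmulr_rle0.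
  apply/rowP => k; rewrite [RHS]mxE.
  have := psumr_eq0P (fun k _ => normsq_ge0 (c^T k 0)) c0 (i := k) isT.
  by move/normsq_eq0; rewrite mxE.
exists (invmx G *m adj M); split; first by rewrite -mulmxA mulVmx.
move=> y; set c := (_ *m _ *m y).
have orth : adj (M *m c) *m (y - M *m c) = 0.
  have Gc : G *m c = adj M *m y by rewrite /c -(mulmxA (invmx G)) mulKVmx.
  by rewrite adj_mul -mulmxA mulmxBr (mulmxA (adj M) M) -/G Gc subrr mulmx0.
apply: le_trans (lbM c) _.
rewrite -[y in X in _ <= X](subrK (M *m c)) addrC normsq_sumD orth mxE /= mulr0 addr0.
by rewrite lerDl; apply: sumr_ge0 => i _; exact: normsq_ge0.
Qed.

End ComplexLinearAlgebra.

Section SpanningSubfamily.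
Context {K : fieldType}.

(** Among the free families with rows in [S], whose sizes are bounded by [n], one of maximal size
    spans [S]: a row outside its span could be adjoined. An arbitrary basis of the span would not
    consist of elements of [S]. *)
Lemma spanning_subfamily n (S : 'rV[K]_n -> Prop) :
  exists k (W : 'M[K]_(k, n)), [/\ (k <= n)%N, forall i, S (row i W) &
    forall s, S s -> (s <= W)%MS].
Proof.
pose P k := `[< exists W : 'M[K]_(k, n), row_free W /\ forall i, S (row i W) >].
have P0 : exists k, P k.
  exists 0%N; apply/asboolP; exists 0; split; last by case.
  by rewrite /row_free mxrank0.
have Pn k : P k -> (k <= n)%N.
  by move=> /asboolP[W [/eqP rW _]]; rewrite -rW; exact: rank_leq_col.
case: (ex_maxnP P0 Pn) => k Pk kmax; move: (Pk) => /asboolP[W [fW SW]].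
exists k, W; split=> //; first exact: Pn.
move=> s Ss; apply: contrapT => sW.
have : P (k + 1)%N; last by move/kmax; rewrite addn1 ltnn.
apply/asboolP; exists (col_mx W s); split.
  rewrite /row_free eqn_leq rank_leq_row /= -addsmxE addn1; move/eqP: fW => {1}<-.
  apply: rank_ltmx; rewrite /ltmx addsmxSl /=; apply: contra_notN sW.
  by apply: submx_trans; exact: addsmxSr.
move=> i; case: (splitP i) => j ij.
  have -> : i = lshift 1 j by exact: val_inj.
  by rewrite rowKu.
have -> : i = rshift k j by exact: val_inj.
by rewrite rowKd row_id.
Qed.

End SpanningSubfamily.

(** The laws are asked only on [H], because integrals of products make sense only for
    square-integrable functions. Positivity is not strict, because functions that agree almost
    everywhere are not identified. *)
Record semi_inner_product {R : rcfType} {V : lmodType R[i]} (H : V -> Prop)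
    (ip : V -> V -> R[i]) : Prop := {
  sip0 : H 0;
  sip_closed : forall a u v, H u -> H v -> H (a *: u + v);
  sip_linear : forall a u v w, H u -> H v -> H w ->
    ip (a *: u + v) w = a * ip u w + ip v w;
  sip_conj : forall u v, H u -> H v -> ip v u = conjc (ip u v);
  sip_ge0 : forall u, H u -> 0 <= complex.Re (ip u u) }.

Section SemiInnerProduct.
Context {R : rcfType} {V : lmodType R[i]} {H : V -> Prop} {ip : V -> V -> R[i]}.
Context (sip : semi_inner_product H ip).
Local Notation C := R[i].
Local Notation q u := (complex.Re (ip u u)).
Local Notation H0 := (sip0 sip).

Lemma sipD_closed u v : H u -> H v -> H (u + v).
Proof. by move=> Hu Hv; rewrite -[u]scale1r; exact: (sip_closed sip). Qed.

Lemma sipZ_closed a u : H u -> H (a *: u).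
Proof. by move=> Hu; rewrite -[_ *: _]addr0; apply: (sip_closed sip) => //; exact: H0. Qed.

Lemma sipB_closed u v : H u -> H v -> H (u - v).
Proof. by move=> Hu Hv; rewrite -scaleN1r; apply: sipD_closed => //; exact: sipZ_closed. Qed.

Lemma sip_sum_closed (I : Type) (s : seq I) (P : pred I) (F : I -> V) :
  (forall i, H (F i)) -> H (\sum_(i <- s | P i) F i).
Proof.
move=> HF; apply: (big_ind H) => //; first exact: H0.
exact: sipD_closed.
Qed.

Lemma sip0l w : H w -> ip 0 w = 0.
Proof.
move=> Hw; have := sip_linear sip 1 H0 H0 Hw.
by rewrite scale1r addr0 mul1r => /eqP; rewrite -subr_eq subrr eq_sym => /eqP.
Qed.

Lemma sipDl u v w : H u -> H v -> H w -> ip (u + v) w = ip u w + ip v w.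
Proof. by move=> Hu Hv Hw; rewrite -[u in LHS]scale1r (sip_linear sip) // mul1r. Qed.

Lemma sipZl a u w : H u -> H w -> ip (a *: u) w = a * ip u w.
Proof.
move=> Hu Hw; rewrite -[_ *: _]addr0 (sip_linear sip) //; last exact: H0.
by rewrite sip0l // addr0.
Qed.

Lemma sipBl u v w : H u -> H v -> H w -> ip (u - v) w = ip u w - ip v w.
Proof.
move=> Hu Hv Hw; rewrite -scaleN1r sipDl ?sipZl ?mulN1r //; exact: sipZ_closed.
Qed.

Lemma sip_suml (I : Type) (s : seq I) (F : I -> V) w : (forall i, H (F i)) -> H w ->
  ip (\sum_(i <- s) F i) w = \sum_(i <- s) ip (F i) w.
Proof.
move=> HF Hw; elim: s => [|i s IH]; first by rewrite !big_nil sip0l.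
by rewrite !big_cons sipDl ?IH //; exact: sip_sum_closed.
Qed.

Lemma sipDr u v w : H u -> H v -> H w -> ip w (u + v) = ip w u + ip w v.
Proof.
move=> Hu Hv Hw; rewrite (sip_conj sip (sipD_closed Hu Hv) Hw) sipDl // rmorphD /=.
by rewrite -(sip_conj sip Hu Hw) -(sip_conj sip Hv Hw).
Qed.

Lemma sipZr a u w : H u -> H w -> ip w (a *: u) = conjc a * ip w u.
Proof.
move=> Hu Hw; rewrite (sip_conj sip (sipZ_closed a Hu) Hw) sipZl // rmorphM /=.
by rewrite -(sip_conj sip Hu Hw).
Qed.

Lemma sipBr u v w : H u -> H v -> H w -> ip w (u - v) = ip w u - ip w v.
Proof.
move=> Hu Hv Hw; rewrite -scaleN1r sipDr ?sipZr //; last exact: sipZ_closed.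
by rewrite rmorphN1 mulN1r.
Qed.

Lemma sip_sumr (I : Type) (s : seq I) (F : I -> V) w : (forall i, H (F i)) -> H w ->
  ip w (\sum_(i <- s) F i) = \sum_(i <- s) ip w (F i).
Proof.
move=> HF Hw; rewrite (sip_conj sip (sip_sum_closed _ _ HF) Hw) sip_suml // rmorph_sum /=.
by apply: eq_bigr => i _; rewrite -(sip_conj sip (HF i) Hw).
Qed.

Lemma sip_real u : H u -> ip u u = (q u)%:C.
Proof.
move=> Hu; have := sip_conj sip Hu Hu; case: (ip u u) => a b /= [] e.
by congr (_ +i* _); lra.
Qed.

Lemma sip_sqD u v : H u -> H v -> q (u + v) = q u + q v + 2 * complex.Re (ip u v).
Proof.
move=> Hu Hv; rewrite sipDl ?sipDr //; try exact: sipD_closed.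
rewrite (sip_conj sip Hu Hv) !ReD; case: (ip u v) => a b /=; ring.
Qed.

Lemma sip_sqZ a u : H u -> q (a *: u) = normsq a * q u.
Proof.
move=> Hu; rewrite sipZl ?sipZr //; last exact: sipZ_closed.
rewrite sip_real //.
by case: a => a b; rewrite /normsq /=; ring.
Qed.

Lemma sip_null u v : H u -> H v -> q u = 0 -> ip v u = 0.
Proof.
move=> Hu Hv qu; set z := ip v u; have [//|z0] := eqVneq z 0.
have y0 : 0 < normsq z.
  by rewrite lt0r normsq_ge0 andbT; apply: contra_neq z0; exact: normsq_eq0.
(* With this [t] the square of [v + t z u] would be [- q v - 2 < 0]. *)
pose t := - (q v + 1) / normsq z.
have := sip_ge0 sip (sipD_closed Hv (sipZ_closed (t%:C * z) Hu)).
rewrite sip_sqD ?sip_sqZ //; last exact: sipZ_closed.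
rewrite sipZr // -/z qu mulr0 addr0.
have -> : complex.Re (conjc (t%:C * z) * z) = t * normsq z.
  by case: (z) => a b; rewrite /normsq /=; ring.
rewrite /t mulfVK ?gt_eqF // => h; exfalso; have := sip_ge0 sip Hv; lra.
Qed.

Section GramSchmidt.
Context (psi : nat -> V) (Hpsi : forall k, H (psi k)).

Definition gs_residual (es : seq V) (p : V) := p - \sum_(u <- es) ip p u *: u.

Definition gs_normalize (u : V) : V :=
  if q u == 0 then 0 else ((Num.sqrt (q u))^-1)%:C *: u.

Fixpoint gs_seq n : seq V :=
  if n is m.+1 then
    rcons (gs_seq m) (gs_normalize (gs_residual (gs_seq m) (psi m)))
  else [::].

Definition gram_schmidt n : V := gs_normalize (gs_residual (gs_seq n) (psi n)).
Local Notation e := gram_schmidt.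
Local Notation res n := (psi n - \sum_(k < n) ip (psi n) (e k) *: e k).

Lemma gs_seqE n : gs_seq n = mkseq e n.
Proof. by elim: n => //= n IH; rewrite mkseqS -IH. Qed.

Lemma gram_schmidtE n : e n = gs_normalize (res n).
Proof.
rewrite /gram_schmidt /gs_residual gs_seqE /mkseq big_map.
by rewrite -(big_mkord xpredT (fun k => ip (psi n) (e k) *: e k)) /index_iota subn0.
Qed.

Lemma gram_schmidt_closed n : H (e n).
Proof.
elim/ltn_ind: n => n IH; rewrite gram_schmidtE /gs_normalize.
case: ifP => _; first exact: H0.
apply/sipZ_closed/sipB_closed => //.
by apply: (big_ind H) => [||k _]; [exact: H0|exact: sipD_closed|apply/sipZ_closed/IH].
Qed.

Lemma res_closed n : H (res n).
Proof.
apply: sipB_closed => //; apply: sip_sum_closed => k.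
exact/sipZ_closed/gram_schmidt_closed.
Qed.

Lemma gram_schmidt_sq n : q (e n) = 0 \/ q (e n) = 1.
Proof.
have Hr := res_closed n; rewrite gram_schmidtE /gs_normalize.
case: eqVneq => [_|r0]; first by left; rewrite sip0l //; exact: H0.
right; rewrite sip_sqZ // /normsq /= expr0n /= addr0 exprVn sqr_sqrtr ?(sip_ge0 sip) //.
by rewrite mulVf.
Qed.

Lemma gram_schmidt_eq0 n : q (e n) = 0 -> e n = 0.
Proof.
have Hr := res_closed n; rewrite gram_schmidtE /gs_normalize.
case: eqVneq => [//|r0]; rewrite sip_sqZ // => /eqP.
rewrite mulf_eq0 (negPf r0) orbF => /eqP/normsq_eq0 ->.
by rewrite scale0r.
Qed.

Lemma gram_schmidt_mul n v : H v -> ip v (e n) * ip (e n) (e n) = ip v (e n).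
Proof.
move=> Hv; have He := gram_schmidt_closed n; rewrite sip_real //.
case: (gram_schmidt_sq n) => [q0|->]; last by rewrite mulr1.
by rewrite sip_null // mul0r.
Qed.

Lemma gram_schmidt_orth_lt n k : (k < n)%N -> ip (e n) (e k) = 0.
Proof.
elim/ltn_ind: n k => n IH k kn.
have He := gram_schmidt_closed.
suff r0 : ip (res n) (e k) = 0.
  rewrite gram_schmidtE /gs_normalize; case: ifP => _; first by rewrite sip0l.
  by rewrite sipZl ?r0 ?mulr0 //; exact: res_closed.
have Hs : H (\sum_(j < n) ip (psi n) (e j) *: e j).
  by apply: sip_sum_closed => j; exact: sipZ_closed.
rewrite sipBl // sip_suml // => [|j]; last exact: sipZ_closed.
rewrite (bigD1 (Ordinal kn)) //= sipZl // gram_schmidt_mul // big1 ?addr0 ?subrr //.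
move=> j jk; rewrite sipZl //.
have [lt_jk|lt_kj|ejk] := ltngtP j k.
- by rewrite (sip_conj sip (He k) (He j)) IH // conjc0 mulr0.
- by rewrite IH // mulr0.
- by move: jk; rewrite -val_eqE /= ejk eqxx.
Qed.

Lemma gram_schmidt_orth n k : n != k -> ip (e n) (e k) = 0.
Proof.
have He := gram_schmidt_closed.
rewrite neq_ltn => /orP[nk|kn]; last exact: gram_schmidt_orth_lt.
by rewrite (sip_conj sip (He k) (He n)) gram_schmidt_orth_lt // conjc0.
Qed.

Definition gs_proj (d : nat) (f : V) := \sum_(k < d) ip f (e k) *: e k.

Lemma gs_proj_closed d f : H (gs_proj d f).
Proof. by apply: sip_sum_closed => k; exact/sipZ_closed/gram_schmidt_closed. Qed.

Lemma gs_proj_orth d f k : H f -> (k < d)%N -> ip (f - gs_proj d f) (e k) = 0.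
Proof.
have He := gram_schmidt_closed.
move=> Hf kd; rewrite sipBl //; last exact: gs_proj_closed.
rewrite sip_suml // => [|j]; last exact: sipZ_closed.
rewrite (bigD1 (Ordinal kd)) //= sipZl // gram_schmidt_mul // big1 ?addr0 ?subrr //.
move=> j jk; rewrite sipZl // gram_schmidt_orth ?mulr0 //.
Qed.

(** The residual of [psi k] is either null, hence orthogonal to everything, or a multiple of [e k].
    So the null residuals discarded by the normalization do not spoil the orthogonality to the
    original functions. *)
Lemma gs_proj_orth_psi d f k : H f -> (k < d)%N -> ip (f - gs_proj d f) (psi k) = 0.
Proof.
have He := gram_schmidt_closed.
move=> Hf kd; have Hp := sipB_closed Hf (gs_proj_closed d f).
have Hs : H (\sum_(j < k) ip (psi k) (e j) *: e j).
  by apply: sip_sum_closed => j; exact: sipZ_closed.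
rewrite -(subrK (\sum_(j < k) ip (psi k) (e j) *: e j) (psi k)) sipDr //; last first.
  exact: res_closed.
rewrite sip_sumr // => [|j]; last exact: sipZ_closed.
rewrite [X in _ + X]big1 ?addr0 => [|j _]; last first.
  by rewrite sipZr // gs_proj_orth ?mulr0 // (ltn_trans (ltn_ord j)).
have [r0|r0] := eqVneq (q (res k)) 0; first by rewrite sip_null //; exact: res_closed.
have : ip (f - gs_proj d f) (e k) = 0 by exact: gs_proj_orth.
rewrite gram_schmidtE /gs_normalize (negPf r0) sipZr //; last exact: res_closed.
move/eqP; rewrite mulf_eq0 => /orP[|/eqP//].
rewrite conjc_eq0 => /eqP/complexI/eqP; rewrite invr_eq0 sqrtr_eq0.
by rewrite leNgt lt0r r0 (sip_ge0 sip) //; exact: res_closed.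
Qed.

Lemma gs_proj_best d f (b : 'I_d -> C) : H f ->
  q (f - gs_proj d f) <= q (f - \sum_(k < d) b k *: psi k).
Proof.
have He := gram_schmidt_closed.
move=> Hf; have Hp := sipB_closed Hf (gs_proj_closed d f).
have Hb k : H (b k *: psi k) by exact: sipZ_closed.
have Hg : H (\sum_(k < d) b k *: psi k) by exact: sip_sum_closed.
have Hd := sipB_closed (gs_proj_closed d f) Hg.
pose p := f - gs_proj d f; pose r := gs_proj d f - \sum_(k < d) b k *: psi k.
have -> : f - \sum_(k < d) b k *: psi k = p + r by rewrite /p /r addrA subrK.
have [Hp' Hr] : H p /\ H r by [].
rewrite (sip_sqD Hp' Hr).
suff -> : ip p r = 0 by rewrite mulr0 addr0 lerDl (sip_ge0 sip).
rewrite sipBr //; last exact: gs_proj_closed.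
have -> : ip p (gs_proj d f) = 0.
  rewrite [X in ip _ X]/gs_proj sip_sumr // => [|j]; last exact: sipZ_closed.
  by rewrite big1 // => k _; rewrite sipZr // gs_proj_orth ?mulr0.
rewrite sip_sumr // big1 ?subr0 // => k _.
by rewrite sipZr // gs_proj_orth_psi ?mulr0.
Qed.

(** Pythagoras. With truncated coefficients it yields Bessel's inequality for a tail, with the least
    squares coefficients the error of the algorithm. The factor [q (e k)] is 0 or 1. *)
Lemma gs_coef_sq d f (c : 'I_d -> C) : H f ->
  q (f - \sum_(k < d) c k *: e k) =
  q (f - gs_proj d f) + \sum_(k < d) normsq (ip f (e k) - c k) * q (e k).
Proof.
have He := gram_schmidt_closed.
move=> Hf; have Hp := sipB_closed Hf (gs_proj_closed d f).
pose a (k : 'I_d) := ip f (e k) - c k.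
have -> : f - \sum_(k < d) c k *: e k = (f - gs_proj d f) + \sum_(k < d) a k *: e k.
  have -> : \sum_(k < d) a k *: e k = gs_proj d f - \sum_(k < d) c k *: e k.
    by rewrite -sumrB; apply: eq_bigr => k _; rewrite scalerBl.
  by rewrite addrA subrK.
have Ha (k : 'I_d) : H (a k *: e k) by exact: sipZ_closed.
have Hs : H (\sum_(k < d) a k *: e k) by exact: sip_sum_closed.
have o : ip (f - gs_proj d f) (\sum_(k < d) a k *: e k) = 0.
  by rewrite sip_sumr // big1 // => k _; rewrite sipZr // gs_proj_orth // mulr0.
rewrite (sip_sqD Hp Hs) o mulr0 addr0; congr (_ + _).
rewrite sip_suml // Re_sum; apply: eq_bigr => k _.
rewrite sip_sumr // (bigD1 k) //= big1 ?addr0 ?sip_sqZ // => j jk.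
by rewrite sipZl ?sipZr // gram_schmidt_orth ?mulr0 // eq_sym.
Qed.

Lemma normsq_coef f k : H f -> normsq (ip f (e k)) * q (e k) = normsq (ip f (e k)).
Proof.
move=> Hf; have He := gram_schmidt_closed k.
case: (gram_schmidt_sq k) => [q0|->]; last by rewrite mulr1.
by rewrite sip_null // normsq0 mul0r.
Qed.

Lemma gs_bessel d d' f : (d <= d')%N -> H f ->
  \sum_(d <= k < d') normsq (ip f (e k)) <= q (f - gs_proj d f).
Proof.
move=> dd' Hf; pose c k := if (k < d)%N then ip f (e k) else 0.
have e1 : \sum_(k < d') c k *: e k = gs_proj d f.
  rewrite -(big_mkord xpredT (fun k => c k *: e k)) (@big_cat_nat _ _ _ d) //=.
  rewrite [X in _ + X]big_nat_cond [X in _ + X]big1 => [|k]; last first.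
    by rewrite andbT /c => /andP[dk _]; rewrite ltnNge dk scale0r.
  by rewrite addr0 big_mkord; apply: eq_bigr => k _; rewrite /c ltn_ord.
have e2 : \sum_(k < d') normsq (ip f (e k) - c k) * q (e k) =
    \sum_(d <= k < d') normsq (ip f (e k)).
  rewrite -(big_mkord xpredT (fun k => normsq (ip f (e k) - c k) * q (e k))).
  rewrite (@big_cat_nat _ _ _ d) //= big_nat_cond big1 => [|k]; last first.
    by rewrite andbT /c => /andP[_ ->]; rewrite subrr normsq0 mul0r.
  rewrite add0r; apply: eq_big_nat => k /andP[dk _].
  by rewrite /c ltnNge dk /= subr0 normsq_coef.
have := gs_coef_sq (fun k : 'I_d' => c k) Hf; rewrite e1 e2 => ->.
by rewrite lerDr (sip_ge0 sip) //; apply: sipB_closed => //; exact: gs_proj_closed.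
Qed.

End GramSchmidt.
End SemiInnerProduct.

(** * Sampling points for square-integrable functions *)

Section SquareIntegrable.
Context {d : measure_display} {T : measurableType d} {R : realType}.
Variable mu : {measure set T -> \bar R}.
Implicit Types f g h : T -> R[i].

Let integ (F : T -> R) := mu.-integrable setT (EFin \o F).

Lemma measurable_normsq f : measurable_fun setT (fun x => complex.Re (f x)) ->
  measurable_fun setT (fun x => complex.Im (f x)) ->
  measurable_fun setT (fun x => normsq (f x)).
Proof. by move=> mR mI; apply: measurable_funD; exact: measurable_funX. Qed.

Lemma L2normE f : L2norm mu f = ((\int[mu]_x (normsq (f x))%:E) `^ 2^-1)%E.
Proof.
rewrite /L2norm unlock; congr (_ `^ _)%E; apply: eq_integral => x _.
rewrite abse_EFin poweR_EFin; congr (_%:E).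
rewrite -[2]/(2%:R) powR_mulrn ?normr_ge0 // real_normK ?num_real //.
by case: (f x) => a b; rewrite /= /normsq sqr_sqrtr ?addr_ge0 ?sqr_ge0.
Qed.

Lemma integrable_dominated (F G : T -> R) : measurable_fun setT F -> (forall x, `|F x| <= G x) ->
  integ G -> integ F.
Proof.
move=> mF FG iG; apply: le_integrable iG => // [|x _ /=].
  exact/measurable_EFinP.
by rewrite lee_fin; apply: (le_trans (FG x)); exact: ler_norm.
Qed.

Lemma EFin_integrableD (F G : T -> R) : integ F -> integ G -> integ (fun x => F x + G x).
Proof. by move=> iF iG; exact: (@integrableD _ _ _ mu setT measurableT _ _ iF iG). Qed.

Lemma EFin_integrableZ a (F : T -> R) : integ F -> integ (fun x => a * F x).
Proof. by move=> iF; exact: (@integrableZl _ _ _ mu setT measurableT a _ iF). Qed.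

Lemma L2P f : L2 mu f <-> [/\ measurable_fun setT (fun x => complex.Re (f x)),
  measurable_fun setT (fun x => complex.Im (f x)) & integ (fun x => normsq (f x))].
Proof.
have pos : (fun x => `|(EFin \o (fun x => normsq (f x))) x|%E) = (fun x => (normsq (f x))%:E).
  by apply/funext => x /=; rewrite ger0_norm // normsq_ge0.
split=> -[mR mI h]; split=> //.
  apply/integrableP; split; first exact/measurable_EFinP/measurable_normsq.
  by rewrite pos; move: h; rewrite L2normE; apply: lty_poweRy; rewrite invr_neq0.
rewrite L2normE; apply: poweR_lty; move/integrableP: h => [_].
by rewrite pos.
Qed.

Lemma L2_integrable_normsq f : L2 mu f -> integ (fun x => normsq (f x)).
Proof. by move=> /L2P[]. Qed.

Lemma L2_mul_integrable f g : L2 mu f -> L2 mu g ->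
  [/\ integ (fun x => complex.Re (f x) * complex.Re (g x)),
      integ (fun x => complex.Im (f x) * complex.Im (g x)),
      integ (fun x => complex.Im (f x) * complex.Re (g x)) &
      integ (fun x => complex.Re (f x) * complex.Im (g x))].
Proof.
move=> /L2P[fR fI fi] /L2P[gR gI gi].
have aux a b (x : T) (u v : R) : a ^+ 2 <= u -> b ^+ 2 <= v -> `|a * b| <= u + v.
  move=> au bv; rewrite ler_norml; have := sqr_ge0 (a - b); have := sqr_ge0 (a + b).
  by nra.
have h1 (z : R[i]) : complex.Re z ^+ 2 <= normsq z by rewrite lerDl sqr_ge0.
have h2 (z : R[i]) : complex.Im z ^+ 2 <= normsq z by rewrite lerDr sqr_ge0.
by split; apply: (integrable_dominated _ _ (EFin_integrableD fi gi)); try exact: measurable_funM; move=> x; exact: aux.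
Qed.

(** The integral of [f] times the conjugate of [g], split into real and imaginary parts because the
    integral is that of real functions. *)
Definition L2inner f g : R[i] :=
  (\int[mu]_x (complex.Re (f x) * complex.Re (g x) + complex.Im (f x) * complex.Im (g x))) +i*
  (\int[mu]_x (complex.Im (f x) * complex.Re (g x) - complex.Re (f x) * complex.Im (g x))).

Lemma L2_0 : L2 mu 0.
Proof.
apply/L2P; split.
- rewrite (_ : (fun _ => _) = cst 0); first exact: measurable_cst.
  by apply/funext.
- rewrite (_ : (fun _ => _) = cst 0); first exact: measurable_cst.
  by apply/funext.
rewrite /integ (_ : (EFin \o _) = cst 0%E); first exact: integrable0.
by apply/funext => x /=; rewrite normsq0.
Qed.

Lemma L2_lin a f g : L2 mu f -> L2 mu g -> L2 mu (a *: f + g).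
Proof.
move=> /L2P[fR fI fi] /L2P[gR gI gi].
have eR : (fun x => complex.Re ((a *: f + g) x)) =
   (fun x => complex.Re a * complex.Re (f x) - complex.Im a * complex.Im (f x) + complex.Re (g x)).
  apply/funext => x; rewrite -[(a *: f + g) x]/(a * f x + g x).
  by case: (a) (f x) (g x) => [p r] [u v] [s t].
have eI : (fun x => complex.Im ((a *: f + g) x)) =
   (fun x => complex.Re a * complex.Im (f x) + complex.Im a * complex.Re (f x) + complex.Im (g x)).
  apply/funext => x; rewrite -[(a *: f + g) x]/(a * f x + g x).
  by case: (a) (f x) (g x) => [p r] [u v] [s t] /=.
have mR : measurable_fun setT (fun x => complex.Re ((a *: f + g) x)).
  rewrite eR; apply: measurable_funD => //; apply: measurable_funB; exact: measurable_funM.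
have mI : measurable_fun setT (fun x => complex.Im ((a *: f + g) x)).
  rewrite eI; apply: measurable_funD => //; apply: measurable_funD; exact: measurable_funM.
apply/L2P; split => //.
apply: (integrable_dominated _ _ (EFin_integrableD (EFin_integrableZ (2 * normsq a) fi) (EFin_integrableZ 2 gi))).
  exact: measurable_normsq.
move=> x; rewrite ger0_norm ?normsq_ge0 // -[(a *: f + g) x]/(a * f x + g x).
by apply: le_trans (normsqD_le _ _) _; rewrite normsqM mulrA.
Qed.

Let intD (F G : T -> R) : integ F -> integ G ->
  \int[mu]_x (F x + G x) = \int[mu]_x F x + \int[mu]_x G x.
Proof. by move=> iF iG; rewrite RintegralD. Qed.

Let intZ a (F : T -> R) : integ F -> \int[mu]_x (a * F x) = a * \int[mu]_x F x.
Proof. by move=> iF; rewrite RintegralZl. Qed.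

Let int3 a b (F G H : T -> R) : integ F -> integ G -> integ H ->
  \int[mu]_x (a * F x + b * G x + H x) =
  a * \int[mu]_x F x + b * \int[mu]_x G x + \int[mu]_x H x.
Proof.
move=> iF iG iH; rewrite (intD (F := fun x => a * F x + b * G x)) //; last first.
  by apply: EFin_integrableD; exact: EFin_integrableZ.
by rewrite intD ?intZ //; exact: EFin_integrableZ.
Qed.

Lemma L2innerE f g : L2 mu f -> L2 mu g -> L2inner f g =
  (\int[mu]_x (complex.Re (f x) * complex.Re (g x)) +
   \int[mu]_x (complex.Im (f x) * complex.Im (g x))) +i*
  (\int[mu]_x (complex.Im (f x) * complex.Re (g x)) -
   \int[mu]_x (complex.Re (f x) * complex.Im (g x))).
Proof.
move=> Lf Lg; have [f1 f2 f3 f4] := L2_mul_integrable Lf Lg.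
by rewrite /L2inner intD // RintegralB.
Qed.

Lemma L2_semi_inner_product : semi_inner_product (L2 mu) L2inner.
Proof.
split.
- exact: L2_0.
- exact: L2_lin.
- move=> z f g h Lf Lg Lh; have Lzfg := L2_lin z Lf Lg.
  have [f1 f2 f3 f4] := L2_mul_integrable Lf Lh.
  have [g1 g2 g3 g4] := L2_mul_integrable Lg Lh.
  rewrite !L2innerE //; case: z {Lzfg} => [a b].
  have ev x : ((a +i* b) *: f + g) x = (a +i* b) * f x + g x by [].
  have rr : \int[mu]_x (complex.Re (((a +i* b) *: f + g) x) * complex.Re (h x)) =
    a * \int[mu]_x (complex.Re (f x) * complex.Re (h x)) +
    (- b) * \int[mu]_x (complex.Im (f x) * complex.Re (h x)) +
    \int[mu]_x (complex.Re (g x) * complex.Re (h x)).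
    rewrite -int3 //; apply: eq_Rintegral => x _; rewrite ev.
    by case: (f x) (g x) (h x) => [? ?] [? ?] [? ?] /=; ring.
  have ii : \int[mu]_x (complex.Im (((a +i* b) *: f + g) x) * complex.Im (h x)) =
    a * \int[mu]_x (complex.Im (f x) * complex.Im (h x)) +
    b * \int[mu]_x (complex.Re (f x) * complex.Im (h x)) +
    \int[mu]_x (complex.Im (g x) * complex.Im (h x)).
    rewrite -int3 //; apply: eq_Rintegral => x _; rewrite ev.
    by case: (f x) (g x) (h x) => [? ?] [? ?] [? ?] /=; ring.
  have ir : \int[mu]_x (complex.Im (((a +i* b) *: f + g) x) * complex.Re (h x)) =
    a * \int[mu]_x (complex.Im (f x) * complex.Re (h x)) +
    b * \int[mu]_x (complex.Re (f x) * complex.Re (h x)) +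
    \int[mu]_x (complex.Im (g x) * complex.Re (h x)).
    rewrite -int3 //; apply: eq_Rintegral => x _; rewrite ev.
    by case: (f x) (g x) (h x) => [? ?] [? ?] [? ?] /=; ring.
  have ri : \int[mu]_x (complex.Re (((a +i* b) *: f + g) x) * complex.Im (h x)) =
    a * \int[mu]_x (complex.Re (f x) * complex.Im (h x)) +
    (- b) * \int[mu]_x (complex.Im (f x) * complex.Im (h x)) +
    \int[mu]_x (complex.Re (g x) * complex.Im (h x)).
    rewrite -int3 //; apply: eq_Rintegral => x _; rewrite ev.
    by case: (f x) (g x) (h x) => [? ?] [? ?] [? ?] /=; ring.
  rewrite rr ii ir ri; apply/eqP; rewrite eq_complex /=; apply/andP; split; apply/eqP; ring.
- move=> f g Lf Lg; rewrite !L2innerE //; apply/eqP; rewrite eq_complex /=.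
  apply/andP; split; apply/eqP.
    by congr (_ + _); apply: eq_Rintegral => x _; rewrite mulrC.
  rewrite opprB; congr (_ - _); apply: eq_Rintegral => x _; exact: mulrC.
- move=> f Lf /=; apply: Rintegral_ge0 => x _.
  by rewrite addr_ge0 // -expr2 sqr_ge0.
Qed.

Lemma L2inner_self f : complex.Re (L2inner f f) = \int[mu]_x normsq (f x).
Proof. by apply: eq_Rintegral => x _; rewrite /normsq !expr2. Qed.

Lemma integral_normsq f : L2 mu f ->
  (\int[mu]_x (normsq (f x))%:E)%E = (complex.Re (L2inner f f))%:E.
Proof.
move=> Lf; rewrite L2inner_self fineK //; apply: integrable_fin_num => //.
exact: L2_integrable_normsq.
Qed.

Lemma L2norm_inner f : L2 mu f -> L2norm mu f = (Num.sqrt (complex.Re (L2inner f f)))%:E.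
Proof.
move=> Lf; rewrite L2normE integral_normsq // poweR_EFin powR12_sqrt //.
by rewrite (sip_ge0 L2_semi_inner_product).
Qed.

End SquareIntegrable.

(** * Sample points from averages *)

Section Selection.
Context {d : measure_display} {T : measurableType d} {R : realType}.
Variable mu : {measure set T -> \bar R}.

Let integ (F : T -> R) := mu.-integrable setT (EFin \o F).

(** By monotone convergence the sum of the series has integral at most [B], so it is finite off a
    negligible set; [tau] is its [fine] part. This serves both for the majorant of the tail and for
    pointwise convergence of the projections. *)
Lemma integrable_series_majorant (g : nat -> T -> R) (B : R) :
  (forall k x, 0 <= g k x) -> (forall k, integ (g k)) ->
  (forall n, \sum_(0 <= k < n) \int[mu]_x g k x <= B) ->
  exists tau : T -> R, exists N : set T, [/\ mu.-negligible N, forall x, 0 <= tau x,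
    integ tau, \int[mu]_x tau x <= B &
    forall x, ~ N x -> forall n, \sum_(0 <= k < n) g k x <= tau x].
Proof.
move=> g0 ig gB; pose F x := (\sum_(0 <= k <oo) (g k x)%:E)%E.
have F0 x : (0 <= F x)%E by apply: nneseries_ge0 => k _ _; rewrite lee_fin.
have mg k : measurable_fun setT (EFin \o g k) by have /integrableP[] := ig k.
have intg k : (\int[mu]_x (g k x)%:E = (\int[mu]_x g k x)%:E)%E.
  by rewrite fineK //; apply: integrable_fin_num => //; exact: ig.
have intF : (\int[mu]_x F x <= B%:E)%E.
  rewrite /F integral_nneseries // => [|k x _]; last by rewrite lee_fin.
  apply: lime_le.
    by apply: is_cvg_nneseries => k _ _; apply: integral_ge0 => x _; rewrite lee_fin.
  apply: nearW => n; under eq_bigr do rewrite intg.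
  by rewrite sumEFin lee_fin; exact: gB.
have mF : measurable_fun setT F.
  apply: (@ge0_emeasurable_sum _ T R setT (fun k => EFin \o g k) xpredT) => [k x _ _|k _ //].
  by rewrite lee_fin.
have iF : mu.-integrable setT F.
  apply/integrableP; split=> //; under eq_integral do rewrite gee0_abs //.
  by apply: le_lt_trans intF _; rewrite ltry.
have mt : measurable_fun setT (fun x => fine (F x)) by exact: measurableT_comp.
exists (fun x => fine (F x)), [set x | ~ (F x \is a fin_num)]; split.
- have := integrable_ae measurableT iF; apply: negligibleS => x /= h; exact/not_implyP.
- by move=> x; rewrite fine_ge0.
- apply: le_integrable iF => //; first exact/measurable_EFinP.
  by move=> x _ /=; case: (F x) (F0 x) => [r||] //= _; rewrite ?normr0 ?leey.
- have it : integ (fun x => fine (F x)).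
    apply: le_integrable iF => //; first exact/measurable_EFinP.
    by move=> x _ /=; case: (F x) (F0 x) => [r||] //= _; rewrite ?normr0 ?leey.
  rewrite -lee_fin fineK; last by apply: integrable_fin_num => //; exact: it.
  apply: le_trans intF; apply: le_integral => //.
  by move=> x _ /=; case: (F x) (F0 x) => //= r _; rewrite ?leey.
move=> x /contrapT Fx n; rewrite -lee_fin fineK // -sumEFin.
by apply: nneseries_lim_ge => k _ _; rewrite lee_fin.
Qed.

Lemma integral_gt0_witness (G : T -> R) (N : set T) : integ G -> mu.-negligible N ->
  0 < \int[mu]_x G x -> exists2 x, ~ N x & 0 < G x.
Proof.
move=> iG [M [mM M0 NM]] G0; apply: contrapT => no.
suff : (\int[mu]_x (G x)%:E <= 0)%E.
  rewrite -[X in (X <= _)%E]fineK; last by apply: integrable_fin_num => //; exact: iG.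
  by rewrite lee_fin leNgt G0.
rewrite (@negligible_integral _ _ _ mu setT M) //.
rewrite -(@integral0 _ _ _ mu (setT `\` M)); apply: le_integral => //.
- exact: measurableD.
- by apply: integrableS iG => //; exact: measurableD.
- exact: integrable0.
move=> x; rewrite in_setE => -[_ Mx]; rewrite lee_fin leNgt; apply/negP => Gx.
by apply: no; exists x => // /NM.
Qed.

(* A complex sample is treated as two real ones, indexed by a boolean, and a
   complex family [a] as the real family of the [a j] and [i a j]. *)
Definition rpart (b : bool) (z : R[i]) : R := if b then complex.Re z else complex.Im z.

Lemma rpartD b z w : rpart b (z + w) = rpart b z + rpart b w.
Proof. by case: b; rewrite /rpart ?ReD ?ImD. Qed.

Lemma rpart_sum b n (F : 'I_n -> R[i]) : rpart b (\sum_i F i) = \sum_i rpart b (F i).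
Proof. by apply: (big_morph _ (rpartD b)); case: b. Qed.

Definition rvec n (h : 'I_n -> T -> R[i]) (w : T * bool) : 'cV[R]_n :=
  \col_i rpart w.2 (h i w.1).

Lemma rvec_qform n (h : 'I_n -> T -> R[i]) (P : 'M[R]_n) : (forall i, L2 mu (h i)) ->
  integ (fun x => qform P (rvec h (x, true)) + qform P (rvec h (x, false))) /\
  \int[mu]_x (qform P (rvec h (x, true)) + qform P (rvec h (x, false))) =
  \sum_i \sum_j P i j * complex.Re (L2inner mu (h i) (h j)).
Proof.
move=> Lh; pose G i j x := complex.Re (h i x) * complex.Re (h j x) +
  complex.Im (h i x) * complex.Im (h j x).
have iG i j : integ (G i j).
  by have [h1 h2 _ _] := L2_mul_integrable (Lh i) (Lh j); exact: EFin_integrableD.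
have -> : (fun x => qform P (rvec h (x, true)) + qform P (rvec h (x, false))) =
    (fun x => \sum_i \sum_j P i j * G i j x).
  apply/funext => x; rewrite !qformE -big_split; apply: eq_bigr => i _ /=.
  rewrite -big_split; apply: eq_bigr => j _ /=; rewrite !mxE /= /G; ring.
have isum (I : Type) (s : seq I) (F : I -> T -> R) : (forall i, integ (F i)) ->
    integ (fun x => \sum_(i <- s) F i x) /\
    \int[mu]_x (\sum_(i <- s) F i x) = \sum_(i <- s) \int[mu]_x F i x.
  move=> iF; elim: s => [|i s [IH1 IH2]].
    rewrite big_nil /Rintegral.
    have e0 : (fun x : T => \sum_(i <- [::]) F i x) = cst 0.
      by apply/funext => x; rewrite big_nil.
    rewrite e0; split; first exact: integrable0.
    by rewrite integral0_eq // => x _; rewrite big_nil.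
  have -> : (fun x => \sum_(j <- i :: s) F j x) = (fun x => F i x + \sum_(i <- s) F i x).
    by apply/funext => x; rewrite big_cons.
  rewrite big_cons -IH2; split; first exact: (EFin_integrableD (iF i) IH1).
  by rewrite RintegralD //; exact: iF.
have iP i j : integ (fun x => P i j * G i j x) by exact: (EFin_integrableZ _ (iG i j)).
have [? ->] := isum _ (index_enum 'I_n) (fun i x => \sum_j P i j * G i j x)
  (fun i => (isum _ _ _ (iP i)).1).
split=> //; apply: eq_bigr => i _.
have [_ ->] := isum _ (index_enum 'I_n) _ (iP i).
by apply: eq_bigr => j _; rewrite RintegralZl //; exact: iG.
Qed.

Lemma sum_offdiag0 n (P : 'M[R]_n) (M : 'I_n -> 'I_n -> R) :
  (forall i j, i != j -> M i j = 0) ->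
  \sum_i \sum_j P i j * M i j = \sum_i P i i * M i i.
Proof.
move=> M0; apply: eq_bigr => i _; rewrite (bigD1 i) //= big1 ?addr0 // => j ji.
by rewrite M0 ?mulr0 // eq_sym.
Qed.

(** Summed over the two real parts and integrated, the form [P] gives [tr P] by orthonormality and
    [Q] gives at most [sum e_k Q_kk]. The difference has a positive integral, so one part at one
    point satisfies the inequality. The sigma type makes every selected point avoid [N]. *)
Lemma barrier_selection r n (a : 'I_r -> T -> R[i]) (b : 'I_n -> T -> R[i])
    (e : 'I_n -> R) (tau : T -> R) (N : set T) :
  (forall i, L2 mu (a i)) -> (forall i, L2 mu (b i)) ->
  (forall i j, complex.Re (L2inner mu (a i) (a j)) = (i == j)%:R) ->
  (forall i j, i != j -> complex.Re (L2inner mu (b i) (b j)) = 0) ->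
  (forall i, complex.Re (L2inner mu (b i) (b i)) <= e i) ->
  mu.-negligible N -> integ tau -> \int[mu]_x tau x <= 1 / 2 ->
  forall (P : 'M[R]_r) (Q : 'M[R]_n), psd Q -> \sum_k e k * Q k k + 1 / 12 < \tr P ->
  exists w : {x | ~ N x} * bool, qform Q (rvec b (sval w.1, w.2)) + tau (sval w.1) / 12 <
    qform P (rvec a (sval w.1, w.2)).
Proof.
move=> La Lb oa ob eb nN it t2 P Q pQ hPQ.
have [iP eP] := rvec_qform P La; have [iQ eQ] := rvec_qform Q Lb.
pose A x := qform P (rvec a (x, true)) + qform P (rvec a (x, false)).
pose B x := qform Q (rvec b (x, true)) + qform Q (rvec b (x, false)).
have iA : integ A by exact: iP.
have iB : integ B by exact: iQ.
have trP : \int[mu]_x A x = \tr P.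
  rewrite eP (sum_offdiag0 _ (M := fun i j => complex.Re (L2inner mu (a i) (a j)))).
    by apply: eq_bigr => i _; rewrite oa eqxx mulr1.
  by move=> i j ij; rewrite oa (negPf ij).
have trQ : \int[mu]_x B x <= \sum_k e k * Q k k.
  rewrite eQ (sum_offdiag0 _ (M := fun i j => complex.Re (L2inner mu (b i) (b j)))) //.
  by apply: ler_sum => i _; rewrite mulrC ler_wpM2r // psd_diag_ge0.
have iB1 : integ (fun x => -1 * B x) by exact: (@EFin_integrableZ _ _ _ mu (-1) _ iB).
(* Each of the two parts pays [tau / 12]; as [tau] has integral at most [1/2], the total is at most
   [1/12]. *)
have it1 : integ (fun x => - (1 / 6) * tau x) by exact: (@EFin_integrableZ _ _ _ mu (- (1 / 6)) _ it).
have iBt : integ (fun x => -1 * B x + - (1 / 6) * tau x) by exact: (EFin_integrableD iB1 it1).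
have [x Nx] : exists2 x, ~ N x & 0 < A x + (-1 * (B x) + (- (1 / 6)) * tau x).
  apply: (integral_gt0_witness (EFin_integrableD iA iBt)) => //.
  have -> : \int[mu]_x (A x + (-1 * (B x) + (- (1 / 6)) * tau x)) =
      \int[mu]_x A x + (-1 * \int[mu]_x B x + (- (1 / 6)) * \int[mu]_x tau x).
    by rewrite (RintegralD measurableT iA iBt) (RintegralD measurableT iB1 it1) !RintegralZl.
  rewrite trP; lra.
rewrite /A /B => h; case: (ltP (qform Q (rvec b (x, true)) + tau x / 12)
  (qform P (rvec a (x, true)))) => h1.
  by exists (exist _ x Nx, true).
by exists (exist _ x Nx, false) => /=; lra.
Qed.

Definition real_double r (a : 'I_r -> T -> R[i]) (i : 'I_(r + r)) : T -> R[i] :=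
  match fintype.split i with inl j => a j | inr j => 'i%C *: a j end.

Lemma real_double_sum r (a : 'I_r -> T -> R[i]) (c : 'I_r -> R[i]) x b :
  \sum_i rvec (real_double a) (x, b) i 0 *
    (match fintype.split i with inl j => complex.Re (c j) | inr j => complex.Im (c j) end) =
  rpart b (\sum_j c j * a j x).
Proof.
rewrite big_split_ord /= -big_split rpart_sum; apply: eq_bigr => j _ /=.
rewrite !mxE /real_double /= (unsplitK (inl _ j)) (unsplitK (inr _ j)).
have -> : ('i%C *: a j) x = 'i%C * a j x by [].
by case: b; case: (c j) (a j x) => [p q] [u v] /=; ring.
Qed.

(** A function and its multiple by [i] are orthogonal for the real part of the inner product, since
    the inner product of a function with itself is real. So doubling preserves orthogonality. *)
Lemma real_double_inner r (a : 'I_r -> T -> R[i]) (Da : forall i, L2 mu (a i)) i j :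
  (forall i j, i != j -> L2inner mu (a i) (a j) = 0) ->
  complex.Re (L2inner mu (real_double a i) (real_double a j)) =
  match fintype.split i, fintype.split j with
  | inl k, inl l | inr k, inr l => complex.Re (L2inner mu (a k) (a l))
  | _, _ => 0
  end.
Proof.
have iR (p : R) : complex.Re (conjc 'i%C * p%:C) = 0 /\ complex.Re ('i%C * p%:C) = 0 by split=> /=; ring.
have sip := L2_semi_inner_product mu; have DZ z k := sipZ_closed sip z (Da k).
move=> oa; rewrite /real_double; case: (fintype.split i) (fintype.split j) => k [] l //.
- rewrite (sipZr sip) //; have [->|kl] := eqVneq k l; last by rewrite oa // mulr0.
  by rewrite (sip_real sip) // (iR _).1.
- rewrite (sipZl sip) //; have [->|kl] := eqVneq k l; last by rewrite oa // mulr0.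
  by rewrite (sip_real sip) // (iR _).2.
rewrite (sipZl sip) // (sipZr sip) //; case: (L2inner mu (a k) (a l)) => p q /=; ring.
Qed.

Lemma L2_real_double r (a : 'I_r -> T -> R[i]) i :
  (forall i, L2 mu (a i)) -> L2 mu (real_double a i).
Proof.
move=> Da; rewrite /real_double; case: (fintype.split i) => k //.
exact: (sipZ_closed (L2_semi_inner_product mu)).
Qed.

Lemma real_double_normsq n (c : 'I_n -> R[i]) :
  \sum_(i < n + n) (\col_i match fintype.split i with
     inl j => complex.Re (c j) | inr j => complex.Im (c j) end : 'cV[R]_(n + n)) i 0 ^+ 2 =
  \sum_j normsq (c j).
Proof.
rewrite big_split_ord /= -big_split; apply: eq_bigr => j _ /=.
by rewrite !mxE (unsplitK (inl _ j)) (unsplitK (inr _ j)).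
Qed.

(** The barrier method controls only one real part of each sample. For the lower bound this
    suffices, as the square of a part is at most [normsq]. For the upper bound the real estimate is
    applied to [c] and to [i c]: the same part of [z] and of [i z] recovers all of [normsq z], at
    the cost of the factor 2. *)
Theorem weighted_sampling_points r n (K : R) (a : 'I_r -> T -> R[i]) (b : 'I_n -> T -> R[i])
    (w : 'I_n -> R) (tau : T -> R) (N : set T) :
  (0 < r)%N -> (0 < n)%N ->
  (forall i, L2 mu (a i)) -> (forall i, L2 mu (b i)) ->
  (forall i j, L2inner mu (a i) (a j) = (i == j)%:R) ->
  (forall i j, i != j -> L2inner mu (b i) (b j) = 0) ->
  (forall i, complex.Re (L2inner mu (b i) (b i)) <= w i) ->
  (forall i, 0 < w i <= 1) -> 2 * r%:R <= K -> 2 * \sum_i w i <= K ->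
  mu.-negligible N -> (forall x, 0 <= tau x) -> integ tau -> \int[mu]_x tau x <= 1 / 2 ->
  forall p : nat, exists (x : 'I_p -> T) (t : 'I_p -> R),
  [/\ forall i, ~ N (x i) /\ 0 <= t i,
    forall c, (p%:R - 4 * K) * \sum_k normsq (c k) <=
      \sum_i t i * normsq (\sum_k c k * a k (x i)),
    forall c, \sum_i t i * normsq (\sum_k c k * b k (x i)) <=
      2 * (4 * K + 3 * p%:R) * \sum_k normsq (c k)
    & \sum_i t i * tau (x i) <= 12 * p%:R].
Proof.
move=> r0 n0 La Lb oa ob bw w01 rK wK nN tau0 it t2 p.
have oa' i j : i != j -> L2inner mu (a i) (a j) = 0 by move=> ij; rewrite oa (negPf ij).
pose e (i : 'I_(n + n)) := match fintype.split i with inl j | inr j => w j end.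
have r0' : (0 < r + r)%N by rewrite addn_gt0 r0.
have n0' : (0 < n + n)%N by rewrite addn_gt0 n0.
have rK' : (r + r)%:R <= K by rewrite natrD; lra.
have e01 i : 0 < e i <= 1 by rewrite /e; case: (fintype.split i).
have eK : \sum_i e i <= K.
  have <- : 2 * \sum_i w i = \sum_i e i.
    rewrite big_split_ord /=; under [X in _ = X + _]eq_bigr do rewrite /e (unsplitK (inl _ _)).
    under [X in _ = _ + X]eq_bigr do rewrite /e (unsplitK (inr _ _)).
    by rewrite mulr2n mulrDl mul1r.
  by [].
have splitD m (i j : 'I_(m + m)) : (i == j) = (fintype.split i == fintype.split j).
  by rewrite (can_eq (@splitK m m)).
have oA i j : complex.Re (L2inner mu (real_double a i) (real_double a j)) = (i == j)%:R.
  rewrite real_double_inner // splitD; case: (fintype.split i) (fintype.split j) => k [] l //.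
    by rewrite oa; case: (k =P l) => [->|kl]; rewrite ?eqxx //; case: eqP => // -[].
  by rewrite oa; case: (k =P l) => [->|kl]; rewrite ?eqxx //; case: eqP => // -[].
have oB i j : i != j -> complex.Re (L2inner mu (real_double b i) (real_double b j)) = 0.
  rewrite real_double_inner // splitD; case: (fintype.split i) (fintype.split j) => k [] l // kl.
    by rewrite ob //; apply: contraNneq kl => ->.
  by rewrite ob //; apply: contraNneq kl => ->.
have eB i : complex.Re (L2inner mu (real_double b i) (real_double b i)) <= e i.
  by rewrite real_double_inner // /e; case: (fintype.split i).
have LA i := L2_real_double i La; have LB i := L2_real_double i Lb.
have sel := barrier_selection LA LB oA oB eB nN it t2.
have [s [<- s0 sA sB st]] := barrier_sparsification
  (v := fun y : {x | ~ N x} * bool => rvec (real_double a) (sval y.1, y.2))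
  (u := fun y => rvec (real_double b) (sval y.1, y.2)) (tau := fun y => tau (sval y.1))
  r0' n0' rK' e01 eK (fun y => tau0 (sval y.1)) sel p.
have t0 : forall i, 0 <= (tnth (in_tuple s) i).2.
  by apply/(@all_tnthP _ _ (fun p => 0 <= p.2) (in_tuple s)).
pose X (i : 'I_(size s)) := tnth (in_tuple s) i.
exists (fun i => sval (X i).1.1), (fun i => (X i).2); split.
- by move=> i; split; [case: (X i).1.1|exact: t0].
- move=> c; have := sA (\col_i match fintype.split i with
     inl j => complex.Re (c j) | inr j => complex.Im (c j) end).
  rewrite real_double_normsq [X in _ <= X]big_tnth => /le_trans; apply; apply: ler_sum => i _.
  rewrite ler_wpM2l ?t0 //.
  under eq_bigr do rewrite [X in _ * X]mxE.
  rewrite real_double_sum /rpart /normsq.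
  by case: ifP => _; rewrite ?lerDl ?lerDr sqr_ge0.
- move=> c; pose v (c : 'I_n -> R[i]) : 'cV[R]_(n + n) := \col_i match fintype.split i with
     inl j => complex.Re (c j) | inr j => complex.Im (c j) end.
  have h1 := sB (v c); have h2 := sB (v (fun k => 'i%C * c k)).
  rewrite /v real_double_normsq [X in X <= _]big_tnth in h1; rewrite /v real_double_normsq [X in X <= _]big_tnth in h2.
  have e2 : \sum_j normsq ('i%C * c j) = \sum_j normsq (c j).
    by apply: eq_bigr => j _; rewrite normsqM /normsq /= expr0n expr1n /= add0r mul1r.
  rewrite e2 in h2; have := lerD h1 h2; rewrite -big_split /= => h.
  apply: le_trans (le_trans h _); last by lra.
  apply: ler_sum => i _; rewrite -mulrDr ler_wpM2l ?t0 //.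
  under [X in _ <= X ^+ 2 + _]eq_bigr do rewrite [X in _ * X]mxE.
  under [X in _ <= _ + X ^+ 2]eq_bigr do rewrite [X in _ * X]mxE.
  rewrite !real_double_sum.
  under [X in _ <= _ + rpart _ X ^+ 2]eq_bigr do rewrite -mulrA.
  rewrite -mulr_sumr; case: (\sum_k _) => z1 z2; rewrite /rpart /normsq /=.
  by case: (tnth _ i).1.2 => /=; lra.
by move: st; rewrite big_tnth.
Qed.

End Selection.

(** * Reconstruction from samples *)

Section Auxiliary.
Context {R : realType}.

Lemma normsq_cauchy (I : Type) (s : seq I) (z w : I -> R[i]) :
  normsq (\sum_(i <- s) z i * w i) <=
  (\sum_(i <- s) normsq (z i)) * (\sum_(i <- s) normsq (w i)).
Proof.
elim: s => [|i s IH]; first by rewrite !big_nil normsq0 mul0r.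
rewrite !big_cons addrC normsqD.
have P0 : 0 <= \sum_(j <- s) normsq (z j) by apply: sumr_ge0 => j _; exact: normsq_ge0.
have Q0 : 0 <= \sum_(j <- s) normsq (w j) by apply: sumr_ge0 => j _; exact: normsq_ge0.
move: (\sum_(j <- s) z j * w j) (\sum_(j <- s) normsq (z j)) (\sum_(j <- s) normsq (w j))
  P0 Q0 IH => A P Q P0 Q0 IH.
have z0 := normsq_ge0 (z i); have w0 := normsq_ge0 (w i).
have hre (y : R[i]) : complex.Re y ^+ 2 <= normsq y by rewrite lerDl sqr_ge0.
have := hre (conjc A * (z i * w i)); rewrite !normsqM normsq_conj.
move: (complex.Re _) (normsq (z i)) (normsq (w i)) z0 w0 => r p q p0 q0 h.
have h1 : r ^+ 2 <= (P * Q) * (p * q).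
  by apply: le_trans h _; rewrite ler_wpM2r // mulr_ge0.
have h2 : (2 * r) ^+ 2 <= (P * q + Q * p) ^+ 2.
  by have := sqr_ge0 (P * q - Q * p); nra.
have h3 : 2 * r <= P * q + Q * p.
  have t0 : 0 <= P * q + Q * p by rewrite addr_ge0 // mulr_ge0.
  rewrite leNgt; apply/negP => lt; move: h2; apply/negP; rewrite -ltNge.
  by rewrite ltr_pXn2r // ?nnegrE // (le_trans t0) // ltW.
by nra.
Qed.

Lemma bounded_series_tail (b : nat -> R) (S eta : R) : (forall l, 0 <= b l) ->
  (forall n, \sum_(0 <= l < n) b l <= S) -> 0 < eta ->
  exists L, (0 < L)%N /\ forall n, (L <= n)%N -> \sum_(L <= l < n) b l <= eta.
Proof.
move=> b0 bS e0; pose A := [set \sum_(0 <= l < n) b l | n in [set: nat]].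
have hA : has_sup A.
  split; first by exists (\sum_(0 <= l < 0) b l); exists 0%N.
  by exists S => _ [n _ <-].
have [_ [L _ <-] hL] := sup_adherent e0 hA.
exists L.+1; split=> // n Ln.
have up : \sum_(0 <= l < n) b l <= sup A by apply: ub_le_sup; [case: hA|exists n].
have := up; rewrite (@big_cat_nat _ _ _ L.+1) //= => h.
have : \sum_(0 <= l < L) b l <= \sum_(0 <= l < L.+1) b l by rewrite big_nat_recr //= lerDl.
by move: hL h; lra.
Qed.

Lemma bounded_series_small (g : nat -> R) (B eps : R) l0 : (forall l, 0 <= g l) ->
  (forall n, \sum_(0 <= l < n) g l <= B) -> 0 < eps ->
  exists l, (l0 <= l)%N /\ g l <= eps.
Proof.
move=> g0 gB e0; have [L [_ hL]] := bounded_series_tail g0 gB e0.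
exists (maxn l0 L); split; first exact: leq_maxl.
apply: le_trans (hL (maxn l0 L).+1 _); last by rewrite leqW // leq_maxr.
rewrite big_nat_recr ?leq_maxr //= lerDr.
by apply: sumr_ge0.
Qed.

(* Block [l], of length [K 2 ^ l], consists of the [k] with
   [block K l <= k < block K l.+1]. *)
Definition block (K l : nat) := (K * (2 ^ l - 1))%N.
Definition level (K k : nat) := trunc_log 2 (k %/ K).+1.

Lemma block_le K l m : (l <= m)%N -> (block K l <= block K m)%N.
Proof. by move=> lm; rewrite leq_mul2l leq_sub2r ?orbT // leq_pexp2l. Qed.

Lemma block1 K : block K 1 = K.
Proof. by rewrite /block muln1. Qed.

Lemma blockS K l : block K l.+1 = (block K l + K * 2 ^ l)%N.
Proof.
rewrite /block expnS mul2n -addnn -mulnDr; congr (_ * _)%N.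
have := expn_gt0 2 l; lia.
Qed.

Lemma level_block K l k : (0 < K)%N -> (block K l <= k < block K l.+1)%N -> level K k = l.
Proof.
move=> K0 /andP[lk kl]; apply: trunc_log_eq => //.
have p1 : (0 < 2 ^ l)%N by rewrite expn_gt0.
have p2 : (0 < 2 ^ l.+1)%N by rewrite expn_gt0.
have h1 : (2 ^ l - 1 <= k %/ K)%N by rewrite leq_divRL // mulnC.
have h2 : (k %/ K < 2 ^ l.+1 - 1)%N by rewrite ltn_divLR // mulnC.
by apply/andP; split; lia.
Qed.

Lemma big_blocks K (F : nat -> R) m n : (m <= n)%N ->
  \sum_(block K m <= k < block K n) F k =
  \sum_(m <= l < n) \sum_(block K l <= k < block K l.+1) F k.
Proof.
move=> mn; rewrite -(subnK mn); elim: (n - m)%N => [|i IH].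
  by rewrite add0n !big_geq.
rewrite addSn (@big_cat_nat _ _ _ (block K (i + m))) ?block_le ?leq_addl //=.
by rewrite IH [RHS]big_nat_recr ?leq_addl.
Qed.

End Auxiliary.

(** * Weighted expansion of the class and error of least squares *)

Section Reconstruction.
Context {d : measure_display} {T : measurableType d} {R : realType}.
Context (mu : {measure set T -> \bar R}).
Context (K : nat) (K0 : (0 < K)%N) (psi : nat -> T -> R[i]) (Lpsi : forall k, L2 mu (psi k))
  (f : nat -> T -> R[i]) (Lf : forall j, L2 mu (f j)) (alpha : nat -> R)
  (alpha0 : forall l, 0 < alpha l) (S : R).
Local Notation beta l := (Num.sqrt 2 ^+ l * alpha l).
Local Notation q g := (complex.Re (L2inner mu g g)).
Context (hS : forall n, \sum_(0 <= l < n) beta l <= S)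
  (happ : forall l j, exists b : 'I_(block K l.+1) -> R[i],
    q (f j - \sum_k b k *: psi k) <= alpha l ^+ 2).
Local Notation sip := (L2_semi_inner_product mu).
Local Notation e := (gram_schmidt (ip := L2inner mu) psi).
Local Notation proj n j := (gs_proj (ip := L2inner mu) psi n (f j)).
Local Notation c j k := (L2inner mu (f j) (e k)).

Let beta0 l : 0 < beta l.
Proof. by rewrite mulr_gt0 // exprn_gt0 // sqrtr_gt0. Qed.

Let beta_sq l : beta l ^+ 2 = 2 ^+ l * alpha l ^+ 2.
Proof. by rewrite exprMn -exprM mulnC exprM sqr_sqrtr. Qed.

Let beta_le l : beta l <= S.
Proof.
apply: le_trans (hS l.+1); rewrite big_nat_recr //= lerDr.
by apply: sumr_ge0 => i _; exact: ltW.
Qed.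

Let S0 : 0 < S.
Proof. exact: lt_le_trans (beta0 0) (beta_le 0). Qed.

Let alpha_le_beta l : alpha l <= beta l.
Proof.
apply: ler_peMl; first exact: ltW.
by apply: exprn_ege1; rewrite -[X in X <= _]sqrtr1 ler_wsqrtr // ler1n.
Qed.

(* The choice makes [alpha l ^+ 2 / block_weight l = S * beta l], summing to at
   most [S ^+ 2], and [2 ^+ l * block_weight l] proportional to [beta l]. *)
Definition block_weight (l : nat) : R := beta l / (2 ^+ l * S).
Definition weight (k : nat) : R := block_weight (level K k).-1.

Let two_pow0 l : 0 < 2 ^+ l :> R.
Proof. by rewrite exprn_gt0. Qed.

Lemma block_weight01 l : 0 < block_weight l <= 1.
Proof.
rewrite divr_gt0 ?mulr_gt0 //= ler_pdivrMr ?mulr_gt0 // mul1r.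
apply: le_trans (beta_le l) _; apply: ler_peMl; first exact: ltW.
by apply: exprn_ege1; rewrite ler1n.
Qed.

Lemma weightE l k : (block K l.+1 <= k < block K l.+2)%N -> weight k = block_weight l.
Proof. by move=> h; rewrite /weight (level_block K0 h). Qed.

Lemma proj_error l j : q (f j - proj (block K l.+1) j) <= alpha l ^+ 2.
Proof.
have [b hb] := happ l j; apply: le_trans hb.
exact: (gs_proj_best sip Lpsi b (Lf j)).
Qed.

(** Block [l.+1] is part of what remains after projecting onto blocks [0] to [l], whose error is
    [alpha l]. This causes the shift between the index of a block and that of [alpha], and the
    predecessor in [weight]. *)
Lemma block_coef l j :
  \sum_(block K l.+1 <= k < block K l.+2) normsq (c j k) <= alpha l ^+ 2.
Proof.
apply: le_trans (proj_error l j); apply: (gs_bessel sip Lpsi _ (Lf j)).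
exact: block_le.
Qed.

Lemma weighted_coef_sum n j : \sum_(K <= k < block K n.+1) normsq (c j k) / weight k <= S ^+ 2.
Proof.
rewrite -{1}(block1 K) big_blocks // big_add1 /=.
have h l : \sum_(block K l.+1 <= k < block K l.+2) normsq (c j k) / weight k <= S * beta l.
  have [w0 _] := andP (block_weight01 l).
  rewrite (eq_big_nat _ _ (F2 := fun k => normsq (c j k) / block_weight l)) => [|k hk]; last first.
    by rewrite (weightE hk).
  rewrite -mulr_suml ler_pdivrMr //; apply: le_trans (block_coef l j) _.
  rewrite /block_weight; have -> : S * beta l * (beta l / (2 ^+ l * S)) = beta l ^+ 2 / 2 ^+ l.
    by field; rewrite !gt_eqF.
  by rewrite beta_sq [2 ^+ l * _]mulrC mulfK // gt_eqF.
apply: (@le_trans _ _ (\sum_(0 <= l < n) S * beta l)).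
  by apply: ler_sum => l _; exact: h.
by rewrite -mulr_sumr expr2 ler_pM2l.
Qed.

(** The factor 2 arises because block [l.+1] has [K * 2 ^ l.+1] elements, while its weight is
    normalized by [2 ^ l]. Since the [beta l] sum to at most [S], all the weights together cost
    [2 K]. *)
Lemma weight_sum m n : (m <= n)%N -> \sum_(block K m.+1 <= k < block K n.+1) weight k =
  2 * K%:R / S * \sum_(m <= l < n) beta l.
Proof.
move=> mn; rewrite big_blocks ?ltnS // big_add1 /= mulr_sumr; apply: eq_big_nat => l _.
rewrite (eq_big_nat _ _ (F2 := fun k => block_weight l)) => [|k hk]; last by rewrite (weightE hk).
rewrite sumr_const_nat blockS addKn -[LHS]mulr_natr natrM natrX exprS /block_weight.
by field; rewrite !gt_eqF.
Qed.

Lemma weight01 k : 0 < weight k <= 1.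
Proof. exact: block_weight01. Qed.

Lemma proj_sub D n j x : (D <= n)%N ->
  (proj n j - proj D j) x = \sum_(D <= k < n) c j k * e k x.
Proof.
move=> Dn; have h m : proj m j x = \sum_(0 <= k < m) c j k * e k x.
  by rewrite /gs_proj fct_sumE big_mkord; apply: eq_bigr.
have -> : (proj n j - proj D j) x = proj n j x - proj D j x by [].
by rewrite !h (@big_cat_nat _ _ _ D 0 n) //= addrAC subrr add0r.
Qed.

(** The remainder is cut at a far level where the projection is already close to [f j x]. In
    between, Cauchy-Schwarz with the factors [c / sqrt w] and [sqrt w * e] gives [S^2 tau]; the 2
    comes from squaring a sum of two terms. *)
Lemma proj_tail L j x tau : (0 < L)%N -> 0 <= tau ->
  (forall n, \sum_(0 <= k < n) weight (block K L.+1 + k) * normsq (e (block K L.+1 + k)%N x) <= tau) ->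
  (forall eps l0, 0 < eps ->
     exists l, (l0 <= l)%N /\ normsq ((f j - proj (block K l.+1) j) x) <= eps) ->
  normsq ((f j - proj (block K L.+1) j) x) <= 2 * S ^+ 2 * tau.
Proof.
move=> L0 tau0 htau hlim; set D := block K L.+1 in htau *.
apply/ler_addgt0Pr => eps eps0.
have [|l [Ll hl]] := hlim (eps / 2) L; first by rewrite divr_gt0.
have Dl : (D <= block K l.+1)%N by exact: block_le.
have -> : (f j - proj D j) x = (f j - proj (block K l.+1) j) x + (proj (block K l.+1) j - proj D j) x.
  by rewrite -[LHS]/(f j x - proj D j x) -[RHS]/(_ - _ + (_ - _)) addrA subrK.
apply: le_trans (normsqD_le _ _) _.
suff : normsq ((proj (block K l.+1) j - proj D j) x) <= S ^+ 2 * tau by lra.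
have W0 k : 0 < weight k by case/andP: (weight01 k).
rewrite proj_sub //.
have -> : \sum_(D <= k < block K l.+1) c j k * e k x =
  \sum_(D <= k < block K l.+1) (((Num.sqrt (weight k))^-1)%:C * c j k) * ((Num.sqrt (weight k))%:C * e k x).
  apply: eq_bigr => k _; rewrite mulrACA -rmorphM mulVf ?mul1r //.
  by rewrite gt_eqF // sqrtr_gt0.
have nC (r : R) z : normsq (r%:C * z) = r ^+ 2 * normsq z.
  by rewrite normsqM /normsq /= expr0n /= addr0.
apply: le_trans (normsq_cauchy _ _ _) _; apply: ler_pM.
- by apply: sumr_ge0 => k _; exact: normsq_ge0.
- by apply: sumr_ge0 => k _; exact: normsq_ge0.
- apply: le_trans (weighted_coef_sum l j).
  rewrite (eq_big_nat _ _ (F2 := fun k => normsq (c j k) / weight k)) => [|k _]; last first.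
    by rewrite nC exprVn sqr_sqrtr ?(ltW (W0 k)) // mulrC.
  have KD : (K <= D)%N by rewrite -{1}(block1 K) block_le.
  rewrite (@big_cat_nat _ _ _ D K) //= lerDr; apply: sumr_ge0 => k _.
  by rewrite divr_ge0 ?normsq_ge0 // ltW.
rewrite (eq_big_nat _ _ (F2 := fun k => weight k * normsq (e k x))) => [|k _]; last first.
  by rewrite nC sqr_sqrtr ?(ltW (W0 k)).
apply: le_trans (htau (block K l.+1 - D)%N).
rewrite -{1}(add0n D) big_addn; apply: ler_sum => k _.
by rewrite addnC.
Qed.

Local Notation W := weight.
Local Notation integ F := (mu.-integrable setT (EFin \o F)).

Let Le k : L2 mu (e k).
Proof. exact: (gram_schmidt_closed sip Lpsi). Qed.

Let Lproj n j : L2 mu (f j - proj n j).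
Proof. by apply: (sipB_closed sip) => //; exact: (gs_proj_closed sip Lpsi). Qed.

Let qe_le1 k : q (e k) <= 1.
Proof. by case: (gram_schmidt_sq sip Lpsi k) => ->. Qed.

Lemma block_addn m n : (block K m + n <= block K (m + n))%N.
Proof.
elim: n => [|n IH]; first by rewrite !addn0.
rewrite !addnS blockS -addn1 leq_add // muln_gt0 K0 expn_gt0 //.
Qed.

(** The threshold makes the weights of the tail sum to at most [(2 K / S) * (S / (4 K)) = 1/2], and
    each [normsq (e k)] has integral at most 1. *)
Lemma tail_majorant L : (forall n, (L <= n)%N -> \sum_(L <= l < n) beta l <= S / (4 * K%:R)) ->
  exists (tau : T -> R) (N : set T), [/\ mu.-negligible N, forall x, 0 <= tau x,
    integ tau, \int[mu]_x tau x <= 1 / 2 &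
    forall x, ~ N x -> forall n,
      \sum_(0 <= k < n) W (block K L.+1 + k) * normsq (e (block K L.+1 + k)%N x) <= tau x].
Proof.
move=> hL; set D := block K L.+1.
have K0' : 0 < K%:R :> R by rewrite ltr0n.
apply: integrable_series_majorant => [k x|k|n].
- by rewrite mulr_ge0 ?normsq_ge0 //; case/andP: (weight01 (D + k)) => /ltW.
- exact: (EFin_integrableZ _ (L2_integrable_normsq (Le _))).
apply: (@le_trans _ _ (\sum_(0 <= k < n) W (D + k))).
  apply: ler_sum => k _; rewrite RintegralZl //; last exact: (L2_integrable_normsq (Le _)).
  rewrite -L2inner_self ler_piMr //; by case/andP: (weight01 (D + k)) => /ltW.
apply: (@le_trans _ _ (\sum_(D <= k < block K (L + n).+1) W k)).
  have Dn : (D + n <= block K (L + n).+1)%N by rewrite -addSn block_addn.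
  have -> : \sum_(0 <= k < n) W (D + k) = \sum_(D <= k < D + n) W k.
    rewrite -[in RHS](add0n D) big_addn add0n addKn.
    by apply: eq_bigr => k _; rewrite addnC.
  rewrite [leRHS](@big_cat_nat _ _ _ (D + n)) ?leq_addr //= lerDl.
  by apply: sumr_ge0 => k _; case/andP: (weight01 k) => /ltW.
rewrite weight_sum ?leq_addr //.
have := hL _ (leq_addr n L); rewrite -(ler_pM2l (x := 2 * K%:R / S)) ?divr_gt0 ?mulr_gt0 //.
by have -> : 2 * K%:R / S * (S / (4 * K%:R)) = 1 / 2 by field; rewrite !gt_eqF.
Qed.

(** The squared errors are summable in [l], because [alpha l ^ 2 <= S * beta l]; so almost
    everywhere their pointwise values are summable and become arbitrarily small. Smallness at some
    far level is all that [proj_tail] asks for. *)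
Lemma projections_converge j : exists N : set T, mu.-negligible N /\ forall x, ~ N x ->
  forall eps l0, 0 < eps ->
    exists l, (l0 <= l)%N /\ normsq ((f j - proj (block K l.+1) j) x) <= eps.
Proof.
have [||n|tau [N [nN _ _ _ hN]]] :=
  @integrable_series_majorant _ T R mu (fun l x => normsq ((f j - proj (block K l.+1) j) x)) (S ^+ 2).
- by move=> k x; exact: normsq_ge0.
- by move=> k; exact: (L2_integrable_normsq (Lproj _ _)).
- apply: (@le_trans _ _ (\sum_(0 <= l < n) S * beta l)); last first.
    by rewrite -mulr_sumr expr2 ler_pM2l.
  apply: ler_sum => l _; rewrite -L2inner_self.
  apply: le_trans (proj_error l j) _; rewrite expr2.
  apply: ler_pM; rewrite ?(ltW (alpha0 l)) //.
  exact: le_trans (alpha_le_beta l) (beta_le l).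
exists N; split=> // x Nx eps l0 eps0.
apply: (bounded_series_small l0 _ (hN x Nx) eps0) => l; exact: normsq_ge0.
Qed.

Local Notation nodes := (32 * K)%N.

(** Each [f j] has its own exceptional set. Their union is negligible because the [f j] form a
    sequence, and for this reason the class is first replaced by a countable dense part. *)
Lemma good_points : exists (D : nat) (tau : T -> R) (N : set T),
  [/\ (K < D)%N /\ mu.-negligible N, (forall x, 0 <= tau x) /\ integ tau /\ \int[mu]_x tau x <= 1 / 2,
    \sum_(K <= k < D) W k <= 2 * K%:R,
    forall j, \sum_(K <= k < D) normsq (c j k) / W k <= S ^+ 2 &
    forall x, ~ N x -> forall j, normsq ((f j - proj D j) x) <= 2 * S ^+ 2 * tau x].
Proof.
have K0' : 0 < K%:R :> R by rewrite ltr0n.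
have [||L [L0 hL]] := bounded_series_tail (b := fun l => beta l) (eta := S / (4 * K%:R)) _ hS.
- by move=> l; exact: ltW.
- by rewrite divr_gt0 // mulr_gt0.
have [tau [N [nN tau0 it t2 htau]]] := tail_majorant hL.
have [Nj hNj] := choice projections_converge.
exists (block K L.+1), tau, (N `|` \bigcup_j Nj j); split=> //.
- split.
    have h1 : (block K 1 <= block K L)%N by exact: block_le.
    have h2 : (0 < K * 2 ^ L)%N by rewrite muln_gt0 K0 expn_gt0.
    by rewrite blockS; move: (leq_add h1 h2); rewrite block1 addn1.
  by apply: negligibleU => //; apply: negligible_bigcup => j; exact: (hNj j).1.
- rewrite -{1}(block1 K) weight_sum //.
  by rewrite mulrAC ler_pdivrMr // ler_pM2l ?mulr_gt0.
- by move=> j; exact: weighted_coef_sum.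
move=> x /not_orP[Nx Njx] j; apply: proj_tail => //.
  exact: htau.
by apply: (hNj j).2 => h; apply: Njx; exists j.
Qed.

Lemma least_squares_reconstruction :
  exists (x : 'I_nodes -> T) (phi : 'I_nodes -> T -> R[i]),
    (forall i, L2 mu (phi i)) /\
    forall j, q (f j - \sum_i f j (x i) *: phi i) <= 125 * S ^+ 2.
Proof.
have [D [tau [N [[KD nN] [tau0 [it t2]] hW hc hN]]]] := good_points.
have hP j : q (f j - proj K j) <= S ^+ 2.
  have := proj_error 0 j; rewrite block1 => /le_trans; apply.
  have a1 := le_trans (alpha_le_beta 0) (beta_le 0).
  by rewrite !expr2; apply: ler_pM; rewrite ?(ltW (alpha0 0)).
(* The lower frame bound needs an orthonormal family, so the zero functions among the first [K] are
   left out; their coefficients in [gam] are set to 0. *)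
pose J := [set k : 'I_K | q (e k) != 0]%SET.
have eJ (k : 'I_K) : k \notin J -> e k = 0.
  by rewrite inE negbK => /eqP; exact: (gram_schmidt_eq0 sip Lpsi).
have qJ (k : 'I_K) : k \in J -> q (e k) = 1.
  by rewrite inE; case: (gram_schmidt_sq sip Lpsi k) => ->; rewrite ?eqxx.
have sumJ (V : nmodType) (F : 'I_K -> V) : (forall k, k \notin J -> F k = 0) ->
    \sum_k F k = \sum_(i < #|J|) F (enum_val i).
  move=> F0; rewrite (bigID (mem J)) /= [X in _ + X]big1 ?addr0 //.
  exact: big_enum_val.
have [J0|J0] := posnP #|J|.
  (* All of the first [K] functions vanish, so the projection is 0 and the zero algorithm already
     has squared error at most [S ^+ 2]. *)
  exists (fun=> point), (fun=> 0); split=> [i|j]; first exact: (sip0 sip).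
  rewrite big1 => [|i _]; last by rewrite scaler0.
  have -> : f j - 0 = f j - proj K j.
    congr (_ - _); rewrite /gs_proj big1 // => k _; rewrite eJ ?scaler0 //.
    by rewrite (card0_eq J0).
  by apply: le_trans (hP j) _; rewrite ler_peMl ?sqr_ge0 // ler1n.
have [k0 Jk0] := card_gt0P J0.
pose a (i : 'I_#|J|) := e (enum_val i).
pose nb := (D - K)%N.
(* After this scaling the squared norms are at most the weights, and the coefficients become
   [c / sqrt W], whose squares sum to at most [S ^+ 2]. *)
pose b (i : 'I_nb) := (Num.sqrt (W (K + i)))%:C *: e (K + i)%N.
have K0' : 0 < K%:R :> R by rewrite ltr0n.
have La i : L2 mu (a i) by exact: Le.
have Lb i : L2 mu (b i) by exact: (sipZ_closed sip).
have oa i l : L2inner mu (a i) (a l) = (i == l)%:R.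
  have [->|il] := eqVneq i l.
    by rewrite (sip_real sip) // /a qJ // enum_valP.
  rewrite /a (gram_schmidt_orth sip Lpsi) //.
  by apply: contra il => /eqP/val_inj/enum_val_inj ->.
have ob i l : i != l -> L2inner mu (b i) (b l) = 0.
  move=> il; rewrite (sipZl sip) // (sipZr sip) // (gram_schmidt_orth sip Lpsi) ?mulr0 //.
  by rewrite eqn_add2l.
have sqW k : Num.sqrt (W k) ^+ 2 = W k by rewrite sqr_sqrtr //; case/andP: (weight01 k) => /ltW.
have nC (r : R) z : normsq (r%:C * z) = r ^+ 2 * normsq z.
  by rewrite normsqM /normsq /= expr0n /= addr0.
have nC1 (r : R) : normsq (r%:C) = r ^+ 2 by rewrite /normsq /= expr0n /= addr0.
have bW i : q (b i) <= W (K + i).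
  rewrite (sip_sqZ sip) // nC1 sqW.
  by rewrite ler_piMr //; case/andP: (weight01 (K + i)) => /ltW.
have W01' (i : 'I_nb) : 0 < W (K + i) <= 1 by exact: weight01.
have shift (V : nmodType) (F : nat -> V) : \sum_(K <= k < D) F k = \sum_(i < nb) F (K + i)%N.
  rewrite -{1}(add0n K) big_addn big_mkord; apply: eq_bigr => i _; by rewrite addnC.
(* The barrier parameter [4 K] is dictated by [wK]: twice the total weight [2 K]. *)
have rK : 2 * #|J|%:R <= 4 * K%:R :> R.
  have : #|J|%:R <= K%:R :> R by rewrite ler_nat -[X in (_ <= X)%N]card_ord max_card.
  by lra.
have wK : 2 * \sum_(i < nb) W (K + i) <= 4 * K%:R.
  by have := hW; rewrite (shift _ W); lra.
have nb0 : (0 < nb)%N by rewrite subn_gt0.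
have [x [t [xt lo up tl]]] := weighted_sampling_points J0 nb0 La Lb oa ob bW W01' rK wK nN tau0 it t2 nodes.
have t0 i : 0 <= t i by case: (xt i).
pose M := \matrix_(i < nodes, k < #|J|) ((Num.sqrt (t i))%:C * a k (x i)).
have ME (g : 'cV_#|J|) i : (M *m g) i 0 = (Num.sqrt (t i))%:C * \sum_k g k 0 * a k (x i).
  by rewrite mxE mulr_sumr; apply: eq_bigr => k _; rewrite mxE mulrAC mulrA.
have nt i z : normsq ((Num.sqrt (t i))%:C * z) = t i * normsq z by rewrite nC sqr_sqrtr.
have K16 : 0 < 16 * K%:R :> R by rewrite mulr_gt0.
have lbM (g : 'cV_#|J|) : 16 * K%:R * \sum_k normsq (g k 0) <= \sum_i normsq ((M *m g) i 0).
  have := lo (fun k => g k 0); rewrite natrM.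
  have -> : 32 * K%:R - 4 * (4 * K%:R) = 16 * K%:R :> R by ring.
  by move=> /le_trans; apply; apply: ler_sum => i _; rewrite ME nt.
have [B [BM Bn]] := least_squares_inverse K16 lbM.
exists x, (fun i => \sum_k (B k i * (Num.sqrt (t i))%:C) *: a k); split.
  by move=> i; apply: (sip_sum_closed sip) => k; exact: (sipZ_closed sip).
move=> j.
(* As [B M = 1], the part of [f j] in the first [K] functions is reproduced exactly; only the
   samples [y] of the remainder disturb the coefficients, by [h = B y]. *)
pose y : 'cV[R[i]]_nodes := \col_i ((Num.sqrt (t i))%:C * (f j - proj K j) (x i)).
pose g : 'cV[R[i]]_#|J| := \col_(k < #|J|) c j (enum_val k : 'I_K).
have projJ z : proj K j z = \sum_k g k 0 * a k z.
  rewrite /gs_proj fct_sumE; rewrite (sumJ _ (fun k => (c j k *: e k) z)).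
    by apply: eq_bigr => k _; rewrite mxE.
  by move=> k kJ; rewrite eJ // scaler0.
have ft : \col_i ((Num.sqrt (t i))%:C * f j (x i)) = M *m g + y.
  apply/matrixP => i l; rewrite (ord1 l) [RHS]mxE ME -projJ !mxE -mulrDr.
  by congr (_ * _); rewrite -[(f j - proj K j) (x i)]/(f j (x i) - proj K j (x i)) addrC subrK.
pose h := B *m y.
(* The functions between [K] and [D] contribute [2 * 224] through the upper frame bound, those
   beyond [D] contribute [4 * 12 * 32 = 1536] through [tau]. *)
have yS : \sum_i normsq (y i 0) <= 1984 * K%:R * S ^+ 2.
  have pt i : normsq (y i 0) <= 2 * (t i * normsq (\sum_(k < nb)
      ((Num.sqrt (W (K + k)))^-1%:C * c j (K + k)%N) * b k (x i))) + 4 * S ^+ 2 * (t i * tau (x i)).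
    rewrite mxE nt.
    have -> : (f j - proj K j) (x i) = (proj D j - proj K j) (x i) + (f j - proj D j) (x i).
      rewrite -[LHS]/(f j (x i) - proj K j (x i)).
      rewrite -[RHS]/((proj D j (x i) - proj K j (x i)) + (f j (x i) - proj D j (x i))); ring.
    rewrite proj_sub ?(ltnW KD) // shift.
    have -> : \sum_(k < nb) c j (K + k)%N * e (K + k)%N (x i) =
       \sum_(k < nb) ((Num.sqrt (W (K + k)))^-1%:C * c j (K + k)%N) * b k (x i).
      apply: eq_bigr => k _; rewrite -[b k (x i)]/(_%:C * e (K + k)%N (x i)) mulrACA -rmorphM.
      by rewrite mulVf ?mul1r // gt_eqF // sqrtr_gt0; case/andP: (weight01 (K + k)).
    have := ler_wpM2l (t0 i) (normsqD_le (\sum_(k < nb)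
      ((Num.sqrt (W (K + k)))^-1%:C * c j (K + k)%N) * b k (x i)) ((f j - proj D j) (x i))).
    move=> /le_trans; apply; have := ler_wpM2l (t0 i) (hN (x i) (xt i).1 j).
    move: (normsq (\sum_(k < nb) _)) (normsq _) => u v; lra.
  apply: (@le_trans _ _ _ _ _ (ler_sum _ (fun i _ => pt i))).
  rewrite big_split /= -!mulr_sumr.
  have u1 := up (fun k : 'I_nb => (Num.sqrt (W (K + k)))^-1%:C * c j (K + k)%N).
  have u2 : \sum_(k < nb) normsq ((Num.sqrt (W (K + k)))^-1%:C * c j (K + k)%N) <= S ^+ 2.
    apply: le_trans (hc j); rewrite shift; apply: ler_sum => k _.
    by rewrite nC exprVn sqW mulrC.
  rewrite natrM in u1 tl.
  have u3 : 2 * (4 * (4 * K%:R) + 3 * (32 * K%:R)) * (\sum_(k < nb)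
     normsq ((Num.sqrt (W (K + k)))^-1%:C * c j (K + k)%N)) <= 224 * K%:R * S ^+ 2.
    have -> : 2 * (4 * (4 * K%:R) + 3 * (32 * K%:R)) = 224 * K%:R :> R by ring.
    by rewrite ler_wpM2l // mulr_ge0 // ltW.
  have u4 : 4 * S ^+ 2 * (\sum_i t i * tau (x i)) <= 4 * S ^+ 2 * (12 * (32 * K%:R)).
    by rewrite ler_wpM2l // mulr_ge0 ?sqr_ge0.
  have := le_trans u1 u3; lra.
(* Division of [1984 K] by the lower frame constant [16 K]. *)
have hS2 : \sum_k normsq (h k 0) <= 124 * S ^+ 2.
  have := le_trans (Bn y) yS; rewrite -/h.
  have -> : 1984 * K%:R * S ^+ 2 = 16 * K%:R * (124 * S ^+ 2) by ring.
  by rewrite ler_pM2l.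
pose gam (k : 'I_K) : R[i] := if k \in J then (g + h) (enum_rank_in Jk0 k) 0 else 0.
have gamE i : gam (enum_val i) = (g + h) i 0 by rewrite /gam enum_valP enum_valK_in.
have -> : \sum_i f j (x i) *: (\sum_k (B k i * (Num.sqrt (t i))%:C) *: a k) = \sum_(k < K) gam k *: e k.
  rewrite (sumJ _ (fun k => gam k *: e k)) => [|k kJ]; last by rewrite eJ // scaler0.
  have eg : g + h = B *m (\col_i ((Num.sqrt (t i))%:C * f j (x i))).
    by rewrite ft mulmxDr mulmxA BM mul1mx.
  under eq_bigr do rewrite scaler_sumr; rewrite exchange_big; apply: eq_bigr => k _ /=.
  rewrite gamE eg mxE scaler_suml; apply: eq_bigr => i _.
  by rewrite scalerA mxE mulrA [_ * (B k i * _)]mulrC.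
rewrite (gs_coef_sq sip Lpsi _ (Lf j)).
have -> : \sum_(k < K) normsq (c j k - gam k) * q (e k) = \sum_k normsq (h k 0).
  rewrite (sumJ _ (fun k => normsq (c j k - gam k) * q (e k))) => [|k kJ]; last first.
    by rewrite eJ // (sip0l sip) ?mulr0 //; exact: (sip0 sip).
  apply: eq_bigr => k _; rewrite qJ ?enum_valP // mulr1 gamE !mxE opprD addrA subrr sub0r normsqN.
  by [].
by have := hP j; lra.
Qed.

End Reconstruction.

(** * Approximation numbers and sampling numbers *)

(* The spanning vectors of [rank_le_on] need not lie in [G]; a maximal
   independent family of values of [T] does. *)
Lemma finite_rank_spanning (F : fieldType) (V W : lmodType F) (n : nat) (U A : set V)
    (T : V -> W) (G : set W) :
  rank_le_on n U T -> A `<=` U -> (forall f, A f -> G (T f)) -> G 0 ->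
  exists psi : nat -> W, (forall i, G (psi i)) /\
    forall f, A f -> exists b : 'I_n -> F, T f = \sum_(i < n) b i *: psi i.
Proof.
move=> [chi hchi] AU GT G0.
have [|a ha] := @choice V 'rV[F]_n
    (fun f a => A f -> T f = \sum_(i < n) a 0 i *: chi i).
  move=> f; have [Af|nA] := pselect (A f); last by exists 0.
  have [a ->] := hchi f (AU f Af); exists (\row_i a i) => _.
  by apply: eq_bigr => i _; rewrite mxE.
have [k [M [kn rM sM]]] := spanning_subfamily (fun s => exists2 f, A f & s = a f).
have [g hg] : {g : 'I_k -> V & forall i, A (g i) /\ row i M = a (g i)}.
  apply: (@choice _ _ (fun i f => A f /\ row i M = a f)) => i.
  by have [f Af e] := rM i; exists f.
exists (fun i => if insub i is Some j then T (g j) else 0); split=> [i|f Af].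
  by case: insubP => // j _ _; apply: GT; exact: (hg j).1.
have /submxP[u hu] : (a f <= M)%MS by apply: sM; exists f.
exists (fun i => if insub (val i) is Some j then u 0 j else 0).
rewrite -(big_mkord xpredT (fun i => (if insub i is Some j then u 0 j else 0) *:
   (if insub i is Some j then T (g j) else 0))) (@big_cat_nat _ _ _ k) //=.
rewrite [X in _ + X]big_nat_cond [X in _ + X]big1 ?addr0 => [|i]; last first.
  by rewrite andbT => /andP[ki _]; rewrite insubN ?scale0r // -leqNgt.
rewrite big_mkord ha // hu.
transitivity (\sum_(j < k) u 0 j *: \sum_(i < n) M j i *: chi i).
  under [RHS]eq_bigr do rewrite scaler_sumr.
  rewrite exchange_big; apply: eq_bigr => i _ /=; rewrite mxE scaler_suml.
  by apply: eq_bigr => j _; rewrite scalerA.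
apply: eq_bigr => j _; rewrite valK; have [Ag e] := hg j; rewrite ha // -e.
by congr (_ *: _); apply: eq_bigr => i _; rewrite mxE.
Qed.

Section Condensation.
Context {R : realType}.

(** Cauchy condensation on the blocks [H 2^n < k <= N] with [N = 2 H 2^n]. Both factors decrease, so
    each of the [N / 2] terms is at least [a N / sqrt N], and the block at least [(sqrt N / 2) a N],
    where [sqrt N = sqrt (2 H) * sqrt 2 ^ n]. *)
Lemma sqrt_condensation (a : nat -> R) (H m : nat) (s : R) :
  (forall k, 0 <= a k) -> (forall k l, (m < k)%N -> (k <= l)%N -> a l <= a k) ->
  (0 < m)%N -> (m <= H)%N ->
  (forall n, \sum_(m.+1 <= k < n) a k / Num.sqrt k%:R <= s) ->
  forall n, \sum_(0 <= l < n) Num.sqrt 2 ^+ l * a (2 * H * 2 ^ l)%N <=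
    2 / Num.sqrt (2 * H)%:R * s.
Proof.
move=> a0 mono m0 mH hs n; have H0 : (0 < H)%N by exact: leq_trans mH.
have sH : 0 < Num.sqrt (2 * H)%:R :> R by rewrite sqrtr_gt0 ltr0n muln_gt0.
have term k : 0 <= a k / Num.sqrt k%:R by rewrite divr_ge0 // sqrtr_ge0.
pose q : R := Num.sqrt (2 * H)%:R / 2; have q0 : 0 < q by rewrite divr_gt0.
have -> : 2 / Num.sqrt (2 * H)%:R = q^-1 by rewrite /q invf_div.
rewrite ler_pdivlMl // mulr_sumr.
suff blk : \sum_(0 <= l < n) q * (Num.sqrt 2 ^+ l * a (2 * H * 2 ^ l)%N) <=
    \sum_(H.+1 <= k < (H * 2 ^ n).+1) a k / Num.sqrt k%:R.
  apply: (le_trans blk); apply: le_trans (hs (H * 2 ^ n).+1).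
  have h1 : (m.+1 <= H.+1)%N by [].
  have h2 : (H.+1 <= (H * 2 ^ n).+1)%N by rewrite ltnS leq_pmulr // expn_gt0.
  by rewrite [leRHS](big_cat_nat h1 h2) /= lerDr; apply: sumr_ge0.
elim: n => [|n IH]; first by rewrite !big_geq // muln1.
have h1 : (H.+1 <= (H * 2 ^ n).+1)%N by rewrite ltnS leq_pmulr // expn_gt0.
have h2 : ((H * 2 ^ n).+1 <= (H * 2 ^ n.+1).+1)%N by rewrite ltnS leq_mul2l leq_exp2l // leqnSn orbT.
rewrite big_nat_recr //= (big_cat_nat h1 h2) /=.
apply: lerD => //.
set N := (2 * H * 2 ^ n)%N.
have eN : (H * 2 ^ n.+1 = N)%N by rewrite expnS mulnCA mulnA.
have N0 : 0 < N%:R :> R by rewrite ltr0n !muln_gt0 expn_gt0 H0.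
apply: (@le_trans _ _ (\sum_((H * 2 ^ n).+1 <= k < (H * 2 ^ n.+1).+1) a N / Num.sqrt N%:R)).
  rewrite sumr_const_nat subSS expnS mulnCA mul2n -addnn addnK -[leRHS]mulr_natr.
  have eNs : Num.sqrt N%:R = Num.sqrt (2 * H)%:R * Num.sqrt 2 ^+ n :> R.
    rewrite /N natrM sqrtrM // natrX; congr (_ * _).
    by apply/eqP; rewrite -(@eqrXn2 _ 2) ?exprn_ge0 ?sqrtr_ge0 // sqr_sqrtr ?exprn_ge0 // -exprM mulnC exprM sqr_sqrtr.
  have N2 : Num.sqrt N%:R ^+ 2 = 2 * (H * 2 ^ n)%:R :> R.
    by rewrite sqr_sqrtr ?ltW // /N -mulnA natrM.
  have sN0 : 0 < Num.sqrt N%:R :> R by rewrite sqrtr_gt0.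
  rewrite /q mulrA [_ / 2 * _]mulrAC -eNs.
  have -> : (H * 2 ^ n)%:R = Num.sqrt N%:R ^+ 2 / 2 :> R by rewrite N2 mulrC mulKf.
  rewrite le_eqVlt; apply/orP; left; apply/eqP; field.
  by rewrite gt_eqF.
rewrite !big_nat; apply: ler_sum => k /andP[k1 k2].
rewrite eN ltnS in k2.
have k0 : 0 < k%:R :> R by rewrite ltr0n (leq_ltn_trans _ k1).
apply: ler_pM; rewrite ?invr_ge0 ?sqrtr_ge0 ?a0 //.
- apply: mono => //; apply: leq_ltn_trans k1.
  by apply: leq_trans mH _; rewrite leq_pmulr // expn_gt0.
- by rewrite lef_pV2 ?posrE ?sqrtr_gt0 // ler_sqrt // ler_nat.
Qed.
End Condensation.

(** * From a dense subset to the whole class *)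

Section Density.
Context {d : measure_display} {T : measurableType d} {R : realType}.
Context (mu : {measure set T -> \bar R}) (X : metricType R) (ev : X -> T -> R[i]).
Local Notation q g := (complex.Re (L2inner mu g g)).
Local Notation sip := (L2_semi_inner_product mu).

(** Only the norm and finitely many point values matter for the error of a fixed algorithm, so a
    finite intersection of neighbourhoods of [g] suffices. *)
Lemma dense_approximation (S : set X) n (x : 'I_n -> T) (g : X) (eta : R) :
  (forall h, L2 mu (ev h)) -> (L2norm mu (ev h - ev g) @[h --> g] --> 0%E) ->
  (forall y, {for g, continuous (fun h : X => ev h y : R[i]^o)}) -> dense S -> 0 < eta ->
  exists s, [/\ S s, q (ev s - ev g) <= eta & forall i, normsq ((ev s - ev g) (x i)) <= eta].
Proof.
move=> Lev cvN cvx dS eta0; have se0 : 0 < Num.sqrt eta by rewrite sqrtr_gt0.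
have nN : nbhs g [set h | (L2norm mu (ev h - ev g)%R < (Num.sqrt eta)%:E)%E].
  have hE : nbhs (0 : \bar R) [set u | (u < (Num.sqrt eta)%:E)%E].
    by apply: open_ereal_lt'; rewrite lte_fin.
  exact: (cvN _ hE).
have nx i : nbhs g [set h | normsq ((ev h - ev g) (x i)) <= eta].
  have /cvgrPdist_lt/(_ (Num.sqrt eta)%:C) := cvx (x i).
  rewrite ltcR => /(_ se0); apply: filterS => h /=.
  rewrite distrC normc_def ltcR => hlt.
  have e : (ev h - ev g) (x i) = ev h (x i) - ev g (x i) by [].
  rewrite e; set z := _ - _ in hlt *.
  have : Num.sqrt (normsq z) ^+ 2 <= Num.sqrt eta ^+ 2.
    by rewrite ler_pXn2r ?nnegrE ?sqrtr_ge0 // ltW.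
  by rewrite !sqr_sqrtr ?normsq_ge0 // ltW.
have nn : nbhs g [set h | (L2norm mu (ev h - ev g)%R < (Num.sqrt eta)%:E)%E /\
    forall i, normsq ((ev h - ev g) (x i)) <= eta].
  exact: filterI nN (filter_forall _ nx).
move: nn; rewrite nbhsE => -[V [oV Vg] VP].
have [s [/VP[h1 h2] Ss]] := dS V (ex_intro _ g Vg) oV.
exists s; split=> //; move: h1; rewrite /= L2norm_inner; last exact: (sipB_closed sip).
rewrite lte_fin => h1.
have p0 : 0 <= q (ev s - ev g) by apply: (sip_ge0 sip); exact: (sipB_closed sip).
have : Num.sqrt (q (ev s - ev g)) ^+ 2 <= Num.sqrt eta ^+ 2.
  by rewrite ler_pXn2r ?nnegrE ?sqrtr_ge0 // ltW.
by rewrite !sqr_sqrtr // ltW.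
Qed.

(** Nonnegativity of the square of [u / 3 - 3 v]. The factor of the main term must be close to 1, so
    that [125] grows to no more than [144]. *)
Lemma sip_sqD_le u v : L2 mu u -> L2 mu v -> q (u + v) <= 10 / 9 * q u + 10 * q v.
Proof.
move=> Lu Lv; have L1 : L2 mu ((1 / 3)%:C *: u) by exact: (sipZ_closed sip).
have L3 : L2 mu ((- 3)%:C *: v) by exact: (sipZ_closed sip).
have := sip_ge0 sip (sipD_closed sip L1 L3).
rewrite (sip_sqD sip L1 L3) (sip_sqD sip Lu Lv) (sip_sqZ sip _ Lu) (sip_sqZ sip _ Lv) (sipZl sip _ Lu L3) (sipZr sip _ Lv Lu).
have -> : complex.Re ((1 / 3)%:C * (conjc (- 3)%:C * L2inner mu u v)) = - complex.Re (L2inner mu u v).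
  by case: (L2inner mu u v) => a b /=; field.
have -> : normsq (1 / 3)%:C = 1 / 9 :> R by rewrite /normsq /=; field.
have -> : normsq (- 3)%:C = 9 :> R by rewrite /normsq /=; ring.
lra.
Qed.

Lemma sip_sq_sum_le (n : nat) (phi : 'I_n -> T -> R[i]) : (forall i, L2 mu (phi i)) ->
  exists C : R, 0 <= C /\ forall (eta : R) (z : 'I_n -> R[i]), 0 <= eta ->
    (forall i, normsq (z i) <= eta) -> q (\sum_i z i *: phi i) <= C * eta.
Proof.
move=> Lphi.
suff [C [C0 hC]] : exists C : R, 0 <= C /\ forall (eta : R) (z : 'I_n -> R[i]), 0 <= eta ->
    (forall i, normsq (z i) <= eta) ->
    q (\sum_(i <- index_enum 'I_n) z i *: phi i) <= C * eta by exists C.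
elim: (index_enum 'I_n) => [|i s [C [C0 hC]]].
  exists 0; split=> // eta z _ _; rewrite big_nil (sip0l sip) ?mul0r //; exact: (sip0 sip).
exists (10 / 9 * q (phi i) + 10 * C); split=> [|eta z eta0 hz].
  by rewrite addr_ge0 // mulr_ge0 // ?(sip_ge0 sip) // divr_ge0.
have Lz j : L2 mu (z j *: phi j) by exact: (sipZ_closed sip).
rewrite big_cons; apply: le_trans (sip_sqD_le (Lz i) _) _.
  exact: (sip_sum_closed sip).
rewrite (sip_sqZ sip) //; have := hC eta z eta0 hz.
have := ler_wpM2r (sip_ge0 sip (Lphi i)) (hz i).
move: (q _) (q _) => u v; lra.
Qed.

Lemma dense_error_bound (S : set X) n (x : 'I_n -> T) (phi : 'I_n -> T -> R[i]) (B : R) :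
  (forall h, L2 mu (ev h)) ->
  (forall g, L2norm mu (ev h - ev g) @[h --> g] --> 0%E) ->
  (forall y, continuous (fun h : X => ev h y : R[i]^o)) -> dense S -> 0 < B ->
  (forall i, L2 mu (phi i)) ->
  (forall s, S s -> q (ev s - \sum_i ev s (x i) *: phi i) <= 125 * B ^+ 2) ->
  forall g, q (ev g - \sum_i ev g (x i) *: phi i) <= 144 * B ^+ 2.
Proof.
move=> Lev cvN cvx dS B0 Lphi hS g.
have [C [C0 hC]] := sip_sq_sum_le Lphi.
have C1 : 0 < 2 + 10 * C by rewrite ltr_wpDr // mulr_ge0.
(* This makes the perturbation [v] satisfy [q v <= B^2 / 4], and [(10/9) * 125 + 10/4 < 144]. *)
pose eta := B ^+ 2 / (4 * (2 + 10 * C)).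
have B2 : 0 < B ^+ 2 by rewrite exprn_gt0.
have eta0 : 0 < eta by rewrite divr_gt0 // mulr_gt0.
have [s [Ss hq hx]] := dense_approximation x Lev (cvN g) (fun y => cvx y g) dS eta0.
set w := ev s - ev g in hq hx.
have Lw : L2 mu w by exact: (sipB_closed sip).
have LA (z : 'I_n -> R[i]) : L2 mu (\sum_i z i *: phi i).
  by apply: (sip_sum_closed sip) => i; exact: (sipZ_closed sip).
pose v : T -> R[i] := (-1) *: w + \sum_i w (x i) *: phi i.
have L1 : L2 mu ((-1) *: w) by exact: (sipZ_closed sip).
have Lv : L2 mu v by exact: (sipD_closed sip).
have eAw : \sum_i w (x i) *: phi i = \sum_i ev s (x i) *: phi i - \sum_i ev g (x i) *: phi i.
  by rewrite -sumrB; apply: eq_bigr => i _; rewrite -scalerBl.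
have -> : ev g - \sum_i ev g (x i) *: phi i = (ev s - \sum_i ev s (x i) *: phi i) + v.
  rewrite /v eAw scaleN1r /w; move: (\sum_i _) (\sum_i _) => a b.
  by apply/funext => y; rewrite /= !fctE; ring.
apply: le_trans (sip_sqD_le (sipB_closed sip (Lev s) (LA _)) Lv) _.
have qv : q v <= (2 + 10 * C) * eta.
  apply: le_trans (sip_sqD_le L1 (LA _)) _.
  rewrite (sip_sqZ sip) //; have := hC eta (fun i => w (x i)) (ltW eta0) hx.
  have -> : normsq (-1 : R[i]) = 1 by rewrite normsqN /normsq /= expr1n expr0n addr0.
  by move: hq (ltW eta0); move: (q w) (q _) => a b; lra.
have e1 : (2 + 10 * C) * eta = B ^+ 2 / 4 by rewrite /eta; field; rewrite gt_eqF.
have := hS s Ss; rewrite e1 in qv.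
by move: qv B2; move: (q v) (q _) (B ^+ 2) => a b c'; lra.
Qed.

End Density.

Lemma rank_le_on_mono (F : nzRingType) (V W : lmodType F) (n n' : nat) (U : set V) (T : V -> W) :
  (n <= n')%N -> rank_le_on n U T -> rank_le_on n' U T.
Proof.
move=> nn' [psi hpsi]; exists (fun i => if insub (val i) is Some j then psi j else 0) => u Uu.
have [a ->] := hpsi u Uu.
exists (fun i => if insub (val i) is Some j then a j else 0).
rewrite -[RHS](big_mkord xpredT (fun i => (if insub i is Some j then a j else 0) *:
   (if insub i is Some j then psi j else 0))) (@big_cat_nat _ _ _ n) //=.
rewrite [X in _ + X]big_nat_cond [X in _ + X]big1 ?addr0 => [|i]; last first.
  by rewrite andbT => /andP[ki _]; rewrite insubN ?scale0r // -leqNgt.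
by rewrite big_mkord; apply: eq_bigr => j _; rewrite valK.
Qed.

Section Widths.
Context {d : measure_display} {T : measurableType d} {R : realType}.
Context (mu : {measure set T -> \bar R}) (X : metricType R) (ev : X -> T -> R[i]).
Local Notation q g := (complex.Re (L2inner mu g g)).
Local Notation sip := (L2_semi_inner_product mu).
Local Notation an n := (approximation_number (range ev) (L2 mu) (L2norm mu) n).

Lemma approximation_number_mono m n : (m <= n)%N -> (an n <= an m)%E.
Proof.
move=> mn; apply: le_ereal_inf_tmp => e [U [h1 h2 h3 h4]]; apply: ereal_inf_lbound.
by exists U; split=> //; exact: rank_le_on_mono h3.
Qed.

Lemma approximation_number_ge0 n : X -> (0 <= an n)%E.
Proof.
move=> g; apply: le_ereal_inf_tmp => e [U [_ _ _ ->]].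
apply: (@le_trans _ _ (L2norm mu (ev g - U (ev g))%R)); first exact: Lnorm_ge0.
by apply: ereal_sup_ubound; exists (ev g) => //; exists g.
Qed.

Lemma approximating_space n (alpha : R) : (forall g, L2 mu (ev g)) -> (an n < alpha%:E)%E ->
  exists psi : nat -> T -> R[i], (forall i, L2 mu (psi i)) /\
    forall g, exists b : 'I_n -> R[i], q (ev g - \sum_i b i *: psi i) <= alpha ^+ 2.
Proof.
move=> Lev /ereal_inf_lt[e [U [_ UL rU ->]] lt].
have AU : range ev `<=` linear_span (range ev).
  move=> f rf; exists 1%N, (fun=> 1), (fun=> f); split=> //.
  by rewrite big_ord1 scale1r.
have [psi [Lpsi hpsi]] := finite_rank_spanning rU AU (fun f rf => UL f (AU f rf)) (L2_0 mu).
exists psi; split=> // g; have rg : range ev (ev g) by exists g.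
have [b eb] := hpsi _ rg; exists b; rewrite -eb.
have Lw : L2 mu (ev g - U (ev g)) by apply: (sipB_closed sip) => //; exact/UL/AU.
have : (L2norm mu (ev g - U (ev g))%R < alpha%:E)%E.
  by apply: le_lt_trans lt; apply: ereal_sup_ubound; exists (ev g).
rewrite L2norm_inner // lte_fin => h.
have q0 : 0 <= q (ev g - U (ev g)) by exact: (sip_ge0 sip).
rewrite -(sqr_sqrtr q0) ler_pXn2r ?nnegrE ?sqrtr_ge0 ?(ltW h) //.
by apply: le_trans (ltW h); exact: sqrtr_ge0.
Qed.

Lemma countable_sequence (S : set X) : countable S -> S !=set0 ->
  exists s : nat -> X, range s = S.
Proof.
move=> /countable_injP[g gi] [y0 Sy0].
have ex n : exists y, S y /\ forall z, S z -> g z = n -> z = y.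
  have [[z [Sz gz]]|no] := pselect (exists z, S z /\ g z = n).
    by exists z; split=> // w Sw gw; apply: gi; rewrite ?inE // gw gz.
  by exists y0; split=> // z Sz gz; exfalso; apply: no; exists z.
have [s hs] := choice ex.
exists s; apply/seteqP; split=> [_ [n _ <-]|y Sy]; first exact: (hs n).1.
by exists (g y) => //; rewrite -((hs (g y)).2 y Sy erefl).
Qed.

Lemma sampling_error_bound (K : nat) (alpha : nat -> R) (S : R) :
  (forall g, L2 mu (ev g)) ->
  (forall g, L2norm mu (ev h - ev g) @[h --> g] --> 0%E) ->
  (forall y, continuous (fun h : X => ev h y : R[i]^o)) ->
  separable_space (X := X) -> X -> (0 < K)%N ->
  (forall l, (an (K * 2 ^ l) < (alpha l)%:E)%E) ->
  (forall n, \sum_(0 <= l < n) Num.sqrt 2 ^+ l * alpha l <= S) ->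
  (lin_sampling_number (range ev) (L2 mu) (L2norm mu) (32 * K) <= (12 * S)%:E)%E.
Proof.
move=> Lev cvN cvx [Q [cQ dQ]] g0 K0 ha hS.
have alpha0 l : 0 < alpha l.
  by rewrite -lte_fin; apply: le_lt_trans (ha l); exact: approximation_number_ge0.
have S0 : 0 < S by apply: lt_le_trans (hS 1%N); rewrite big_nat1 expr0 mul1r.
have [Psi hPsi] := choice (fun l => approximating_space Lev (ha l)).
have Q0 : Q !=set0.
  by have [y [_ Qy]] := dQ setT (ex_intro _ g0 I) openT; exists y.
have [s rs] := countable_sequence cQ Q0.
(* The spaces of all levels are concatenated. They need not be nested, so in [happ] the approximant
   of level [l] uses block [l] alone, with coefficient 0 on the earlier blocks. *)
pose psi k := Psi (level K k) (k - block K (level K k))%N.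
have Lpsi k : L2 mu (psi k) by exact: (hPsi _).1.
have happ l j : exists b : 'I_(block K l.+1) -> R[i],
    q (ev (s j) - \sum_k b k *: psi k) <= alpha l ^+ 2.
  have [b hb] := (hPsi l).2 (s j).
  pose b' k : R[i] := if insub (k - block K l)%N is Some i then b i else 0.
  exists (fun k => if (block K l <= k)%N then b' k else 0).
  suff -> : \sum_(k < block K l.+1) (if (block K l <= k)%N then b' k else 0) *: psi k =
    \sum_i b i *: Psi l i by [].
  have bl : (block K l <= block K l.+1)%N by exact: block_le.
  rewrite -(big_mkord xpredT (fun k => (if (block K l <= k)%N then b' k else 0) *: psi k)).
  rewrite (@big_cat_nat _ _ _ (block K l)) //= big_nat_cond big1 ?add0r => [|k]; last first.
    by rewrite andbT => /andP[_ kl]; rewrite leqNgt kl scale0r.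
  rewrite blockS -{1}[block K l]add0n [(_ + K * _)%N]addnC big_addn addnK big_mkord.
  apply: eq_bigr => i _; rewrite leq_addl /b' addnK valK /psi.
  rewrite (@level_block K l) // ?addnK // leq_addl /= blockS addnC ltn_add2l.
  exact: ltn_ord.
have [x [phi [Lphi hphi]]] := least_squares_reconstruction K0 Lpsi (fun j => Lev (s j)) alpha0 hS happ.
apply: ge_ereal_inf; exists (ereal_sup [set L2norm mu (f - \sum_(i < 32 * K) f (x i) *: phi i) | f in range ev]).
  by exists x, phi.
apply: ge_ereal_sup => _ [_ [g _ <-] <-].
have LA (z : 'I_(32 * K) -> R[i]) : L2 mu (\sum_i z i *: phi i).
  by apply: (sip_sum_closed sip) => i; exact: (sipZ_closed sip).
rewrite L2norm_inner; last exact: (sipB_closed sip).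
have hQ y : Q y -> q (ev y - \sum_i ev y (x i) *: phi i) <= 125 * S ^+ 2.
  by rewrite -rs => -[j _ <-]; exact: hphi.
have := dense_error_bound Lev cvN cvx dQ S0 Lphi hQ g.
have S12 : 0 <= 12 * S by rewrite mulr_ge0 // ltW.
rewrite lee_fin -(ger0_norm S12) => h.
rewrite -sqrtr_sqr; apply: ler_wsqrtr; apply: (le_trans h).
by rewrite exprMn -natrX ler_wpM2r ?sqr_ge0.
Qed.

End Widths.

Lemma geometric_perturbation_sum {R : realType} (eps : R) n : 0 <= eps ->
  \sum_(0 <= l < n) Num.sqrt 2 ^+ l * (eps / (Num.sqrt 2 ^+ l * 2 ^+ l.+1)) <= eps.
Proof.
move=> e0; suff -> : \sum_(0 <= l < n) Num.sqrt 2 ^+ l * (eps / (Num.sqrt 2 ^+ l * 2 ^+ l.+1)) =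
    eps - eps / 2 ^+ n by rewrite gerBl divr_ge0 // exprn_ge0.
elim: n => [|n IH]; first by rewrite big_geq // expr0 divr1 subrr.
rewrite big_nat_recr //= IH exprS; field.
by rewrite !gt_eqF // ?exprn_gt0 // sqrtr_gt0.
Qed.

Theorem corollary3 :
  exists c : nat, (0 < c)%N /\
  forall (R : realType) (d : measure_display) (D : measurableType d)
    (mu : {measure set D -> \bar R})
    (X : metricType R) (ev : X -> D -> R[i]),
    separable_function_space ev ->
    continuously_embedded ev (L2 mu) (L2norm mu) ->
    forall m : nat, (0 < m)%N ->
    (lin_sampling_number (range ev) (L2 mu) (L2norm mu) (c * m)
     <= ((Num.sqrt m%:R)^-1)%:E *
        \sum_(m.+1 <= k <oo)
          approximation_number (range ev) (L2 mu) (L2norm mu) k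
          * ((Num.sqrt k%:R)^-1)%:E)%E.
Proof.
(* Here [2 * (12 * 24) = 24^2], so [sqrt (2 H) = 24 sqrt m]. The loss [2 / (24 sqrt m)] of the
   condensation times the error factor 12 is exactly [1 / sqrt m]. *)
exists (32 * (2 * (12 * 24)))%N; split=> //.
move=> R d D mu X ev [_ sepX cvx] [Lev cvN] m m0.
have [[g0]|nX] := pselect (inhabited X); last first.
  (* For an empty class every supremum of errors is [-oo]. *)
  apply: le_trans (leNye _); apply: ge_ereal_inf; exists -oo%E => //.
  exists (fun=> point), (fun=> 0); split=> [_|]; first exact: L2_0.
  have -> : range ev = set0 by apply/seteqP; split=> [y [g _ _]|y []]; case: nX; exists.
  by rewrite image_set0 ereal_sup0.
set A := approximation_number _ _ _; set s := (\sum_(_ <= k <oo) _)%E.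
have A0 k : (0 <= A k)%E by exact: approximation_number_ge0.
have A0' k : (0 <= A k * ((Num.sqrt k%:R)^-1)%:E)%E.
  by rewrite mule_ge0 // lee_fin invr_ge0 sqrtr_ge0.
have s0 : (0 <= s)%E by apply: nneseries_ge0.
have sm : 0 < Num.sqrt m%:R :> R by rewrite sqrtr_gt0 ltr0n.
have [sy|sfin] := eqVneq s +oo%E; first by rewrite sy gt0_muley ?lte_fin ?invr_gt0 // leey.
have sr : s = (fine s)%:E by rewrite fineK // ge0_fin_numE // ltey.
have part n : (\sum_(m.+1 <= k < n) A k * ((Num.sqrt k%:R)^-1)%:E <= (fine s)%:E)%E.
  by rewrite -sr; apply: nneseries_lim_ge.
have Afin k : (m < k)%N -> A k = (fine (A k))%:E.
  move=> mk; rewrite fineK // ge0_fin_numE // ltey; apply/eqP => Ay.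
  have := part k.+1; rewrite big_nat_recr //= Ay gt0_mulye; last first.
    by rewrite lte_fin invr_gt0 sqrtr_gt0 ltr0n (leq_ltn_trans _ mk).
  by rewrite addey // -ltNye (lt_le_trans ltNy0) // sume_ge0.
(* For [k <= m] the value [A k] may be infinite, and [fine] then returns 0; monotonicity of [a] is
   therefore claimed only beyond [m], where convergence of the series forces finite values. *)
pose a k := fine (A k); pose H := (12 * 24 * m)%N.
have a0 k : 0 <= a k by rewrite fine_ge0.
have mH : (m <= H)%N by rewrite leq_pmull.
have mono k l : (m < k)%N -> (k <= l)%N -> a l <= a k.
  move=> mk kl; rewrite -lee_fin -!Afin ?(leq_trans mk) //.
  exact: approximation_number_mono.
have apart n : \sum_(m.+1 <= k < n) a k / Num.sqrt k%:R <= fine s.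
  rewrite -lee_fin; apply: le_trans (part n); rewrite -sumEFin !big_nat.
  by apply: lee_sum => k /andP[mk _]; rewrite EFinM -Afin.
have cond := sqrt_condensation a0 mono m0 mH apart.
have sH : Num.sqrt (2 * H)%:R = 24 * Num.sqrt m%:R :> R.
  have -> : (2 * H)%:R = 24 ^+ 2 * m%:R :> R by rewrite /H !natrM; ring.
  by rewrite sqrtrM ?sqr_ge0 // sqrtr_sqr ger0_norm.
rewrite sr -EFinM.
apply/lee_addgt0Pr => eps eps0.
pose del := eps / 12; have del0 : 0 < del by rewrite divr_gt0.
(* The infimum that defines an approximation number need not be attained, so each level is raised by
   a positive amount. The factor [sqrt 2 ^ l] in the denominator cancels the one in the sum, leaving
   a geometric series bounded by [del]. *)
pose al l := a (2 * H * 2 ^ l)%N + del / (Num.sqrt 2 ^+ l * 2 ^+ l.+1).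
have H0 : (0 < H)%N by exact: leq_trans mH.
have hal l : (A (2 * H * 2 ^ l)%N < (al l)%:E)%E.
  rewrite Afin; last first.
    by apply: leq_ltn_trans mH _; rewrite -mulnA mulnCA -expnS ltn_Pmulr // -{1}(expn0 2) ltn_exp2l.
  by rewrite lte_fin ltrDl divr_gt0 // mulr_gt0 // exprn_gt0 // sqrtr_gt0.
have hS n : \sum_(0 <= l < n) Num.sqrt 2 ^+ l * al l <= fine s / (12 * Num.sqrt m%:R) + del.
  under eq_bigr do rewrite mulrDr; rewrite big_split /=; apply: lerD; last first.
    exact/geometric_perturbation_sum/ltW.
  apply: le_trans (cond n) _; rewrite sH le_eqVlt; apply/orP; left; apply/eqP; field.
  by rewrite gt_eqF.
have -> : (32 * (2 * (12 * 24)) * m = 32 * (2 * H))%N by rewrite /H !mulnA.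
apply: le_trans (sampling_error_bound Lev cvN cvx sepX g0 _ hal hS) _.
  by rewrite muln_gt0.
rewrite -EFinD lee_fin /del le_eqVlt; apply/orP; left; apply/eqP; field.
by rewrite gt_eqF.
Qed.
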